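(* Let $(\mathcal S,d,\mu)$ be a space of homogeneous type with quasimetric constant $\kappa$ and doubling constant $C_\mu$, and let $M$ be the Hardy-Littlewood maximal function on it. There is a constant $A_{\mu\kappa}>0$, depending only on $\kappa$ and $C_\mu$, such that for every $1<p<\infty$ and every weight $w\in A_p$, with $\sigma=w^{1-p'}$ and $\frac1p+\frac1{p'}=1$, $$\|M\|_{L^p(w)}\le A_{\mu\kappa}\left(\frac1{p-1}\,[w]_{A_p}[\sigma]_{A_\infty}\right)^{1/p},$$ where $\|M\|_{L^p(w)}$ is the operator norm of $M$ on $L^p(w)=L^p(\mathcal S,w\,d\mu)$.
   Context: A quasimetric on a set $\mathcal S$ is a function $d:\mathcal S\times\mathcal S\to[0,\infty)$ with $d(x,y)=0$ iff $x=y$, $d(x,y)=d(y,x)$, and $d(x,y)\le\kappa(d(x,z)+d(z,y))$ for all $x,y,z$, for some finite constant $\kappa\ge1$ (the quasimetric constant). Balls are $B(x,r)=\{y\in\mathcal S: d(x,y)<r\}$, $r>0$. A space of homogeneous type $(\mathcal S,d,\mu)$ is a set with a quasimetric $d$ and a nonnegative Borel measure $\mu$ such that $\mu(B(x,2r))\le C\mu(B(x,r))$ for all $x\in\mathcal S$, $r>0$; $C_\mu$ denotes the smallest such constant. Standing assumptions: $0<\mu(B)<\infty$ for every ball $B$; $d$ is continuous and balls are open; the Lebesgue differentiation theorem holds on $(\mathcal S,d,\mu)$. A weight is a nonnegative measurable function on $\mathcal S$. For $1<p<\infty$, $w\in A_p$ means $$[w]_{A_p}:=\sup_B\left(\frac1{\mu(B)}\int_B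 w\,d\mu\right)\left(\frac1{\mu(B)}\int_B w^{-\frac1{p-1}}\,d\mu\right)^{p-1}<\infty,$$ the supremum being over all balls in $\mathcal S$ (with the convention $0\cdot\infty=\infty$, so that $A_p$ weights are locally integrable and a.e. positive). The (uncentered) Hardy-Littlewood maximal function is $Mf(x)=\sup_{B\ni x}\frac1{\mu(B)}\int_B|f|\,d\mu$ (supremum over balls $B$ containing $x$). With $w(B)=\int_B w\,d\mu$, the $A_\infty$ constant of a weight is $$[w]_{A_\infty}:=\sup_B\frac1{w(B)}\int_B M(w\chi_B)\,d\mu .$$ *)

(* Defs.v *)
From HB Require Import structures.
From mathcomp Require Import all_boot all_order all_algebra.
From mathcomp Require Import all_classical all_reals all_analysis.
From mathcomp Require Import measurable_realfun.

Set Implicit Arguments.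
Unset Strict Implicit.
Unset Printing Implicit Defensive.

Import Order.TTheory GRing.Theory Num.Theory.
Import numFieldNormedType.Exports.

Local Open Scope classical_set_scope.
Local Open Scope ring_scope.

Section quasimetric.
Context {R : realType} {S : Type}.
Implicit Type d : S -> S -> R.

Record quasimetric d (kappa : R) : Prop := Quasimetric {
  qm_const_ge1 : 1 <= kappa ;
  qm_ge0 : forall x y, 0 <= d x y ;
  qm_eq0 : forall x y, d x y = 0 <-> x = y ;
  qm_sym : forall x y, d x y = d y x ;
  qm_triangle : forall x y z, d x y <= kappa * (d x z + d z y)
}.

Definition qball d (x : S) (r : R) : set S := [set y | d x y < r].

Definition qballs d : set (set S) :=
  [set B | exists x r, 0 < r /\ B = qball d x r].

(* The topology induced by [d]. For a quasimetric, balls need not be open. *)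
Definition qopen d : set (set S) :=
  [set U | forall x, U x -> exists2 r, 0 < r & qball d x r `<=` U].

Definition qnbhs d (x : S) : set_system S :=
  filter_from [set U | qopen d U /\ U x] id.

Definition qcontinuous d : Prop := forall x y,
  (fun z : S * S => d z.1 z.2) @ filter_prod (qnbhs d x) (qnbhs d y) --> d x y.

End quasimetric.

Section homogeneous.
Context {R : realType} {disp : measure_display} {S : measurableType disp}.
Variables (d : S -> S -> R) (mu : {measure set S -> \bar R}).

Definition doubling (C : R) : Prop := forall x r, 0 < r ->
  (mu (qball d x (2 * r)) <= C%:E * mu (qball d x r))%E.

Definition doubling_constant (C : R) : Prop :=
  doubling C /\ forall C', doubling C' -> C <= C'.

Definition differentiation_thm : Prop := forall f : S -> R,
  measurable_fun setT f ->
  (forall B, qballs d B -> mu.-integrable B (EFin \o f)) ->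
  {ae mu, forall x, (fun r : R =>
     (fine (mu (qball d x r)))^-1 * \int[mu]_(y in qball d x r) f y)
       @ (0 : R)^'+ --> f x}.

Record homogeneous_space (kappa Cmu : R) : Prop := HomogeneousSpace {
  hs_quasimetric : quasimetric d kappa ;
  hs_borel : @measurable disp S = <<s qopen d >> ;
  hs_doubling : doubling_constant Cmu ;
  hs_ball_gt0 : forall B, qballs d B -> (0 < mu B)%E ;
  hs_ball_fin : forall B, qballs d B -> (mu B < +oo)%E ;
  hs_continuous : qcontinuous d ;
  hs_ball_open : forall B, qballs d B -> qopen d B ;
  hs_differentiation : differentiation_thm
}.

End homogeneous.

Local Open Scope ereal_scope.

Section extended_nonneg.
Context {R : realType}.
Implicit Type x y : \bar R.

(* Real powers on [0, +oo] with 0 ^ a = +oo and +oo ^ a = 0 for a < 0; the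
   library's [poweR] has 0 `^ a = 0 and +oo `^ a = +oo there. *)
Definition npow x (a : R) : \bar R :=
  if (0 <= a)%R then x `^ a else x^-1 `^ (- a).

(* The product on [0, +oo] with 0 * +oo = +oo. *)
Definition mule_oo x y : \bar R :=
  if (x == +oo) || (y == +oo) then +oo else x * y.

End extended_nonneg.

Section weights.
Context {R : realType} {disp : measure_display} {S : measurableType disp}.
Variables (d : S -> S -> R) (mu : {measure set S -> \bar R}).
Implicit Types (f w : S -> \bar R) (p : R) (B : set S).

(* Weights take values in [0, +oo], so that w ^ (1 - p') is again a weight. *)
Definition weight w : Prop :=
  measurable_fun setT w /\ forall x, 0 <= w x.

Definition ball_avg f B : \bar R := (mu B)^-1 * \int[mu]_(x in B) f x.

Definition Ap_const p w : \bar R :=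
  ereal_sup [set mule_oo (ball_avg w B)
                   (ball_avg (fun x => npow (w x) (- (p - 1)^-1)) B `^ (p - 1))
            | B in qballs d].

Definition Ap p w : Prop := weight w /\ Ap_const p w < +oo.

Definition maximal f (x : S) : \bar R :=
  ereal_sup [set ball_avg (abse \o f) B | B in [set B | qballs d B /\ B x]].

(* [w \_ B] is w times the indicator function of B. *)
Definition Ainfty_const w : \bar R :=
  ereal_sup [set (\int[mu]_(x in B) w x)^-1 *
                   \int[mu]_(x in B) maximal (w \_ B) x
            | B in qballs d].

Definition wLnorm p w f : \bar R :=
  (\int[mu]_x (`|f x| `^ p * w x)) `^ p^-1.

Definition maximal_opnorm p w : \bar R :=
  ereal_sup [set wLnorm p w (maximal (EFin \o f))
            | f in [set f : S -> R | measurable_fun setT f /\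
                                     wLnorm p w (EFin \o f) <= 1]].

End weights.

(* Main.v *)
Require Import Defs.
From HB Require Import structures.
From mathcomp Require Import all_boot all_order all_algebra finmap.
From mathcomp Require Import all_classical all_reals all_analysis.
From mathcomp Require Import measurable_realfun.
From mathcomp Require Import ring lra.

Import Order.TTheory GRing.Theory Num.Theory.
Import numFieldNormedType.Exports.

Local Open Scope classical_set_scope.
Local Open Scope ring_scope.

(** The proof avoids dyadic cubes and follows Buckley's scheme: an [A_p] weight
    is also an [A_q] weight for some [q < p], the maximal function is of weak
    type [(q, q)] with respect to it, and a decomposition into levels turns
    this into the strong type [(p, p)]. The whole point is that [p - q] can be
    taken of size [(p - 1) / A], where [A] is the A_infty constant of the dual
    weight [sigma], without spoiling the [A_p] constant; summing over levels
    costs a factor [1 / (p - q)], which is the factor [A / (p - 1)] of the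
    theorem.

    The exponent [q] comes from a reverse Hoelder inequality for [sigma]
    ([reverse_hoelder]): with [e] of size [1 / A], the average of
    [sigma ^ (1 + e)] over a ball is at most a constant times the power
    [1 + e] of the average of [sigma] over a dilated ball. Let [M] be the
    maximal function of [sigma] with radii at most that of the ball, and [O_t]
    the set where [M] exceeds [t]. Cover [O_t] by balls of almost maximal
    radius among those with average above [t]: on a dilation of such a ball,
    [M] is at most the maximal function of the restriction of [sigma] to a
    larger dilation plus a multiple of [t], and there the average of [sigma]
    is again at most a multiple of [t]. By definition of
    the A_infty constant, the integral of [M] over [O_t] is therefore at most
    a multiple of [A t mu(O_t)]. Multiplying by [e t ^ (e - 1)] and summing
    over [t], this bounds the integral of [M ^ (1 + e)] by a small multiple of
    itself plus a main term.

    In a quasimetric space the covering balls stick out of the original ball,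
    possibly with most of their mass, so that the two integrals are not over
    the same set. The sets [nbhd i] handle this: they grow by steps decreasing
    faster than the powers of the quasimetric constant, and therefore stay in
    a fixed dilated ball, while covering balls for levels above the [i]-th one
    are so small that they go from [nbhd i] only to [nbhd i.+1]. The resulting
    chain of inequalities is summed in [level_iteration].

    Every covering argument is an instance of [vitali_integral]. All layer
    decompositions are discrete, over levels in geometric progression, so that
    no product measure is needed. *)

Set Implicit Arguments.
Unset Strict Implicit.
Unset Printing Implicit Defensive.

(** * Selecting disjoint sets *)

Section selection.
Context {R : realType}.

(** The selection is a maximal element among the disjoint subfamilies that
    already dominate every set they meet: a set meeting none of the selected
    ones could be added if its radius were at least half of the supremum of
    the radii of such sets. *)
Lemma vitali_selection {S I : Type} (B : I -> set S) (rad : I -> R)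
    (F : set I) (M : R) :
    (forall i, F i -> 0 < rad i <= M) -> (forall i, F i -> B i !=set0) ->
  exists G : set I, [/\ G `<=` F, trivIset G B & forall i, F i ->
    exists j, [/\ G j, B i `&` B j !=set0 & rad i <= 2 * rad j]].
Proof.
move=> radF B0.
pose dom (G : set I) := forall i, F i ->
  (exists2 j, G j & B i `&` B j !=set0) ->
  exists j, [/\ G j, B i `&` B j !=set0 & rad i <= 2 * rad j].
(* Without [dom], a maximal disjoint subfamily need not meet every set of the
   family in a set of comparable radius. *)
pose P := [set G : set I | [/\ G `<=` F, trivIset G B & dom G]].
have [G [[GF GB Gdom] Gmax]] : exists G, P G /\ forall H, G `<` H -> ~ P H.
  apply: Zorn_bigcup => C CP Ctot; split.
  - by apply: bigcup_sub => G /CP[].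
  - move=> i j [G CG Gi] [H CH Hj] ij.
    have [GH|HG] := Ctot _ _ CG CH.
      by have [_ + _] := CP _ CH; apply => //; exact: GH.
    by have [_ + _] := CP _ CG; apply => //; exact: HG.
  - move=> i Fi [j [G CG Gj] ij]; have [_ _ Gdom] := CP _ CG.
    have [|k [Gk ik rk]] := Gdom i Fi; first by exists j.
    by exists k; split => //; exists G.
exists G; split => // i Fi; apply: (Gdom) => //; apply: contrapT => iG.
pose U := [set k | F k /\ ~ exists2 j, G j & B k `&` B j !=set0].
have hsU : has_sup (rad @` U).
  split; first by exists (rad i), i.
  by exists M => _ [k [Fk _] <-]; have /andP[] := radF k Fk.
have supU : 0 < sup (rad @` U).
  apply: (@lt_le_trans _ _ (rad i)); first by have /andP[] := radF i Fi.
  by apply: ub_le_sup; [exact: hsU.2|exists i].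
have [|_ [k [Fk kG] <-] supk] := @sup_adherent _ _ (sup (rad @` U) / 2) _ hsU.
  by rewrite divr_gt0.
(* The set [k] has almost the largest radius among the sets that meet no
   selected one, so adding it preserves [dom]. *)
have Gk : ~ G k.
  by move=> Gk; apply: kG; exists k => //; rewrite setIid; exact: B0.
apply: (Gmax (G `|` [set k])).
  split; first by move=> j; left.
  by move=> /(_ k (or_intror erefl)).
split.
- by move=> j [/GF//|->].
- move=> a b [Ga|->] [Gb|->] // ab; first exact: GB.
    by exfalso; apply: kG; exists a => //; rewrite setIC.
  by exfalso; apply: kG; exists b.
- move=> a Fa [b Gb ab].
  have [aG|aG] := pselect (exists2 j, G j & B a `&` B j !=set0).
    by have [j [Gj aj rj]] := Gdom a Fa aG; exists j; split => //; left.
  case: Gb => [Gb|bk]; first by exfalso; apply: aG; exists b.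
  exists k; split; [by right|by rewrite -bk|].
  have : rad a <= sup (rad @` U) by apply: ub_le_sup; [exact: hsU.2|exists a].
  lra.
Qed.

Lemma set0_or_nonempty {T} (A : set T) : A = set0 \/ A !=set0.
Proof. by have [->|/set0P] := eqVneq A set0; [left|right]. Qed.

Lemma le_measure_set {disp} {S : measurableType disp}
    (mu : {measure set S -> \bar R}) (A B : set S) :
  measurable A -> measurable B -> A `<=` B -> (mu A <= mu B)%E.
Proof. by move=> mA mB; apply: le_measure; rewrite inE. Qed.

(** Each of countably many sets of finite measure contains only finitely many
    disjoint sets of measure at least a given positive number. *)
Lemma countable_trivIset_measure_gt0 {disp} {S : measurableType disp}
    (mu : {measure set S -> \bar R}) {I : choiceType} (G : set I)
    (B : I -> set S) (V : nat -> set S) :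
    trivIset G B -> (forall i, G i -> measurable (B i)) ->
    (forall i, G i -> (0 < mu (B i))%E) ->
    (forall n, measurable (V n)) -> (forall n, (mu (V n) < +oo)%E) ->
    (forall i, G i -> exists n, B i `<=` V n) ->
  countable G.
Proof.
move=> GB mB B0 mV Voo BV.
pose H (nm : nat * nat) := [set i | [/\ G i, B i `<=` V nm.1 &
  ((nm.2.+1%:R^-1)%:E <= mu (B i))%E]].
suff finH nm : finite_set (H nm).
  apply: (@sub_countable _ _ _ (\bigcup_nm H nm)); last first.
    by apply: bigcup_countable => // nm _; exact: finite_set_countable.
  apply: subset_card_le => i Gi; have [n Bn] := BV i Gi.
  have muBfin : mu (B i) \is a fin_num.
    rewrite ge0_fin_numE//; apply: le_lt_trans (Voo n).
    by apply: le_measure_set => //; exact: mB.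
  have /ltr_add_invr[m Hm] : 0 < fine (mu (B i)).
    by rewrite fine_gt0// B0//= ltey_eq muBfin.
  exists (n, m) => //; split => //=.
  by rewrite -(fineK muBfin) lee_fin ltW// -[ltLHS]add0r.
apply: contrapT => /infinite_set_fset.
have Vfin : mu (V nm.1) \is a fin_num by rewrite ge0_fin_numE.
pose N := (Num.truncn (fine (mu (V nm.1)) * nm.2.+1%:R)).+1.
move=> /(_ N)[X XH NX].
have XG : [set` X] `<=` G by move=> i /XH[].
have : (mu (\big[setU/set0]_(i <- enum_fset X) B i) <= mu (V nm.1))%E.
  apply: le_measure_set => //.
    by rewrite big_seq; apply: bigsetU_measurable => i iX; apply/mB/XG.
  rewrite -bigcup_seq; apply: bigcup_sub => i /= iX.
  by have [] := XH i iX.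
rewrite measure_fbigsetU//; last exact: sub_trivIset GB.
  apply/negP; rewrite -ltNge.
  apply: (@lt_le_trans _ _ (\sum_(i <- enum_fset X) (nm.2.+1%:R^-1)%:E)%E).
    rewrite -(fineK Vfin) sumEFin lte_fin big_const_seq count_predT.
    rewrite iter_addr_0 -[ltRHS]mulr_natl ltr_pdivlMr//.
    rewrite (lt_le_trans (truncnS_gt _))// ler_nat//.
  rewrite big_seq [leRHS]big_seq; apply: lee_sum => i iX.
  by have [] := XH i iX.
by move=> i iX; apply: mB; exact: XG.
Qed.

End selection.

(** * Sums over geometric levels *)

Section levels.
Context {R : realType}.

(** The terms grow at least geometrically, so the largest one dominates. *)
Lemma sum_geometric_le (a : nat -> R) (C X : R) (b : pred nat) (n : nat) :
    1 <= C -> 0 <= X -> (forall k, 0 <= a k) ->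
    (forall k, C * a k <= (C - 1) * a k.+1) ->
    (forall k, b k -> a k <= X) ->
  \sum_(k < n | b k) a k <= C * X.
Proof.
move=> C1 X0 a0 aS bX.
have total m : \sum_(k < m.+1) a k <= C * a m.
  elim: m => [|m IH]; first by rewrite big_ord1 ler_peMl.
  rewrite big_ord_recr/=; apply: le_trans (lerD IH (lexx _)) _.
  by have := aS m; lra.
elim: n => [|n IH]; first by rewrite big_ord0 mulr_ge0// (le_trans ler01).
rewrite big_mkcond big_ord_recr/= -big_mkcond/=.
case: ifPn => [bn|_]; last by rewrite addr0.
apply: (@le_trans _ _ (\sum_(k < n.+1) a k)).
  rewrite [leRHS]big_ord_recr/= lerD2r big_mkcond/=.
  by apply: ler_sum => k _; case: ifP.
by apply: le_trans (total n) _; rewrite ler_wpM2l ?bX// (le_trans ler01).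
Qed.

Lemma powR_le_affine (D e : R) : 1 <= D -> 0 < e < 1 ->
  D `^ e <= 1 + e * D.
Proof.
move=> D1 /andP[e0 e1]; have De0 : 0 <= D by rewrite (le_trans ler01).
have e1' : 0 < 1 - e by rewrite subr_gt0.
have := @conjugate_powR R (D `^ e) 1 e^-1 (1 - e)^-1 (powR_ge0 _ _) ler01.
rewrite !invr_gt0 !invrK => /(_ e0 e1').
rewrite -powRrM mulfV ?gt_eqF// powRr1// powR1 mulr1.
have -> : e + (1 - e) = 1 by ring.
by move=> /(_ erefl); nra.
Qed.

Context (D e t0 : R) (D2 : 2 <= D) (e01 : 0 < e < 1) (t0_gt0 : 0 < t0).

Local Notation t k := (D ^+ k * t0).
Local Notation T k := (t k `^ e).

Let D1 : 1 <= D. Proof. by apply: le_trans D2; rewrite ler1n. Qed.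
Let D0 : 0 < D. Proof. by apply: lt_le_trans D2. Qed.
Let e0 : 0 < e. Proof. by case/andP: e01. Qed.
Let t_gt0 k : 0 < t k. Proof. by rewrite mulr_gt0// exprn_gt0. Qed.
Let T_ge0 k : 0 <= T k. Proof. exact: powR_ge0. Qed.

Let tS k : t k.+1 = D * t k. Proof. by rewrite exprS mulrA. Qed.

Let TS k : T k.+1 = D `^ e * T k.
Proof. by rewrite tS powRM// ltW. Qed.

Let T_le k : T k <= T k.+1.
Proof.
rewrite TS ler_peMl//.
by rewrite -(powRr0 D) ler_powR// ltW.
Qed.

Let T_homo i k : (i <= k)%N -> T i <= T k.
Proof.
move=> /subnK <-; elim: (k - i)%N => [//|j IH].
by rewrite addSn; apply: le_trans IH (T_le _).
Qed.

Let T_expr i : T i <= D ^+ i * T 0.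
Proof.
elim: i => [|i IH]; first by rewrite expr0 !mul1r.
rewrite TS exprS -[leRHS]mulrA ler_pM ?powR_ge0//.
by rewrite ler1_powR// ltW//; case/andP: e01.
Qed.

(** A discrete form of writing a power as the integral of its derivative. *)
Lemma level_power_le i k n : (k <= n)%N ->
  T k <= T i + e * D * \sum_(j < n | (i <= j < k)%N) T j.
Proof.
elim: k => [|k IH] kn.
  rewrite big_pred0 ?mulr0 ?addr0 ?T_homo// => j; last by rewrite ltn0 andbF.
have [ki|ik] := ltnP k i.
  rewrite (le_trans (T_homo ki))// lerDl mulr_ge0 ?mulr_ge0 ?(ltW D0) ?(ltW e0)//.
  exact: sumr_ge0.
rewrite (bigD1 (Ordinal kn)) /=; last by rewrite ik ltnSn.
rewrite (eq_bigl (fun j : 'I_n => (i <= j < k)%N)); last first.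
  move=> j /=; rewrite -val_eqE/= ltnS [in RHS]ltn_neqAle.
  by rewrite -andbA [X in _ && X]andbC.
have := IH (ltnW kn).
have : T k.+1 <= (1 + e * D) * T k.
  by rewrite TS ler_wpM2r// powR_le_affine.
by rewrite mulrDr mulrDl mul1r; lra.
Qed.

(** For the reverse Hoelder inequality, [g i k] is the measure of the [k]-th
    superlevel set of a maximal function within the [i]-th neighbourhood of a
    ball, [m i k] the integral of that function there, and [c] is
    proportional to the A_infty constant. Expanding the power [e] into levels
    bounds the [i]-th sum by a main term and a multiple of the sum of index
    [i.+1]; when [e] is small against [c], this multiple is at most [1/2]
    after normalisation by [D ^+ i], so the a priori bound [V] is eventually
    forgotten. *)
Lemma level_iteration (c V W : R) (n : nat) (g m : nat -> nat -> R) :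
    0 <= W -> 0 <= c -> 4 * e * D ^+ 2 * c <= 1 ->
    (forall i k, 0 <= g i k <= V) ->
    (forall i j, \sum_(k < n | (j <= k)%N) t k * g i k <= 2 * m i j) ->
    (forall i k, (i <= k)%N -> m i k <= c * t k * g i.+1 k) ->
    (forall i k, m i k <= W) ->
  forall i, \sum_(k < n) T k * t k * g i k <= D ^+ i * (4 * T 0 * W).
Proof.
move=> W0 c0 small gV layer next mW.
pose Gam i := \sum_(k < n) T k * t k * g i k.
have g0 i k : 0 <= g i k by have /andP[] := gV i k.
have tg0 i k : 0 <= t k * g i k by rewrite mulr_ge0// ltW.
have eD0 : 0 <= e * D by rewrite mulr_ge0 ?(ltW e0) ?(ltW D0).
have step i : Gam i <= 2 * T i * W + 2 * (e * D) * c * Gam i.+1.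
  apply: (@le_trans _ _ (\sum_(k < n) (T i + e * D * \sum_(j < n | (i <= j < k)%N) T j)
      * (t k * g i k))).
    apply: ler_sum => k _; rewrite -mulrA ler_wpM2r//.
    exact/level_power_le/ltnW.
  under eq_bigr do rewrite mulrDl.
  rewrite big_split/= -mulr_sumr lerD//.
    rewrite [2 * _]mulrC -mulrA ler_wpM2l//.
    by apply: le_trans (layer i 0%N) _; rewrite ler_wpM2l.
  (* Fubini for the pairs of levels [j < k]. *)
  have -> : \sum_(k < n) e * D * (\sum_(j < n | (i <= j < k)%N) T j) * (t k * g i k) =
      e * D * \sum_(j < n | (i <= j)%N) T j * \sum_(k < n | (j < k)%N) t k * g i k.
    rewrite mulr_sumr.
    under eq_bigr do rewrite -mulrA mulr_suml mulr_sumr.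
    rewrite (exchange_big_dep (fun j : 'I_n => (i <= j)%N))/=; last first.
      by move=> k j _ /andP[].
    apply: eq_bigr => j ij; rewrite mulr_sumr mulr_sumr.
    by apply: eq_bigl => k; rewrite ij.
  rewrite [leRHS](_ : _ = e * D * (2 * c * Gam i.+1)); last by ring.
  rewrite ler_wpM2l// /Gam mulr_sumr big_mkcond/=; apply: ler_sum => j _.
  have TtG : 0 <= T j * t j * g i.+1 j by rewrite -mulrA mulr_ge0.
  case: ifPn => [ij|_]; last by rewrite mulr_ge0// mulr_ge0.
  have -> : 2 * c * (T j * t j * g i.+1 j) = T j * (2 * (c * t j * g i.+1 j)) by ring.
  rewrite ler_wpM2l//; apply: (@le_trans _ _ (2 * m i j)).
    apply: le_trans (layer i j); rewrite big_mkcond [leRHS]big_mkcond/=.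
    apply: ler_sum => k _; case: ifPn => [jk|_]; first by rewrite (ltnW jk).
    by case: ifP.
  by rewrite ler_wpM2l// next.
pose V' := \sum_(k < n) T k * t k * V.
have V0 : 0 <= V by have /andP[a b] := gV 0%N 0%N; exact: le_trans b.
have V'0 : 0 <= V'.
  by apply: sumr_ge0 => k _; rewrite mulr_ge0// mulr_ge0// ltW.
have TW0 : 0 <= T 0%N * W by rewrite mulr_ge0.
have bound N : forall i, Gam i <= D ^+ i * (4 * T 0 * W + V' / 2 ^+ N).
  elim: N => [|N IH] i.
    rewrite expr0 divr1; apply: (@le_trans _ _ V').
      apply: ler_sum => k _; have /andP[_ gVik] := gV i k.
      by apply: ler_wpM2l gVik; exact: mulr_ge0 (T_ge0 k) (ltW (t_gt0 k)).
    have : V' <= D ^+ i * V' by rewrite ler_peMl// exprn_ege1.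
    have : 0 <= D ^+ i * (T 0%N * W) by rewrite mulr_ge0// exprn_ge0// ltW.
    lra.
  apply: le_trans (step i) _.
  have Y0 : 0 <= 4 * T 0%N * W + V' / 2 ^+ N.
    by rewrite addr_ge0 ?mulr_ge0 ?invr_ge0 ?exprn_ge0.
  have Di : 0 <= D ^+ i by rewrite exprn_ge0// ltW.
  have h1 : 2 * T i * W <= D ^+ i * (2 * T 0 * W).
    have -> : D ^+ i * (2 * T 0%N * W) = 2 * (D ^+ i * T 0%N) * W by ring.
    by rewrite ler_wpM2r// ler_wpM2l// T_expr.
  have h2 : 2 * (e * D) * c * Gam i.+1 <=
      D ^+ i * ((4 * T 0%N * W + V' / 2 ^+ N) / 2).
    apply: (@le_trans _ _ (2 * (e * D) * c *
        (D ^+ i.+1 * (4 * T 0%N * W + V' / 2 ^+ N)))).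
      by rewrite ler_wpM2l// !mulr_ge0// ?(ltW e0) ?(ltW D0).
    rewrite exprS; set Y := 4 * T 0%N * W + _ in Y0 *.
    have -> : 2 * (e * D) * c * (D * D ^+ i * Y) =
      (4 * e * D ^+ 2 * c) * (D ^+ i * (Y / 2)) by field.
    by rewrite ler_piMl// mulr_ge0// divr_ge0.
  apply: le_trans (lerD h1 h2) _.
  have -> : V' / 2 ^+ N.+1 = V' / 2 ^+ N / 2 by rewrite exprS; field; rewrite expf_neq0.
  by rewrite -mulrDr ler_wpM2l//; lra.
move=> i; rewrite -/(Gam i); apply/ler_addgt0Pr => z z0.
have Di : 0 < D ^+ i by rewrite exprn_gt0.
pose N := Num.truncn (D ^+ i * V' / z).
apply: le_trans (bound N i) _; rewrite mulrDr lerD2l.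
rewrite mulrA ler_pdivrMr ?exprn_gt0//.
have : D ^+ i * V' / z < N.+1%:R by exact: truncnS_gt.
rewrite ltr_pdivrMr// => /ltW/le_trans; apply.
rewrite mulrC ler_pM2l// -natrX ler_nat.
by elim: N => // N IH; rewrite expnS mul2n -addnn -[N.+2]addn1 leq_add// expn_gt0.
Qed.

End levels.

(** * Balls of a space of homogeneous type *)

Section balls.
Context {R : realType} {disp : measure_display} {S : measurableType disp}.
Context {d : S -> S -> R} {mu : {measure set S -> \bar R}} {kappa Cmu : R}.
Context (hs : homogeneous_space d mu kappa Cmu).

Local Notation ball := (qball d).
Local Notation vol x r := (fine (mu (ball x r))).

Lemma kappa_ge1 : 1 <= kappa.
Proof. exact: qm_const_ge1 (hs_quasimetric hs). Qed.

Lemma dist_ge0 x y : 0 <= d x y.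
Proof. exact: qm_ge0 (hs_quasimetric hs) _ _. Qed.

Lemma distC x y : d x y = d y x.
Proof. exact: qm_sym (hs_quasimetric hs) _ _. Qed.

Lemma distxx x : d x x = 0.
Proof. exact/(qm_eq0 (hs_quasimetric hs)). Qed.

Lemma dist_triangle z x y : d x y <= kappa * (d x z + d z y).
Proof. exact: qm_triangle (hs_quasimetric hs) _ _ _. Qed.

Lemma dist_triangle_lt z x y a b :
  d x z < a -> d z y < b -> d x y < kappa * (a + b).
Proof.
move=> xz zy; apply: le_lt_trans (dist_triangle z x y) _.
by rewrite ltr_pM2l ?ltrD// (lt_le_trans ltr01 kappa_ge1).
Qed.

Lemma qball_center x r : 0 < r -> ball x r x.
Proof. by move=> r0; rewrite /qball/= distxx. Qed.

Lemma qball_subset_center x y r s t :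
  d y x <= s -> kappa * (s + r) <= t -> ball x r `<=` ball y t.
Proof.
move=> yx st v; rewrite /qball/= => xv; apply: lt_le_trans st.
apply: le_lt_trans (dist_triangle x y v) _.
by rewrite ltr_pM2l ?ler_ltD// (lt_le_trans ltr01 kappa_ge1).
Qed.

Lemma qball_subset x r s : r <= s -> ball x r `<=` ball x s.
Proof. by move=> rs v; rewrite /qball/= => /lt_le_trans; apply. Qed.

Lemma measurable_qopen (U : set S) : qopen d U -> measurable U.
Proof. by rewrite (hs_borel hs) => ?; exact: sub_gen_smallest. Qed.

Lemma qopen_qball x r : qopen d (ball x r).
Proof.
have [r0|r0] := ltP 0 r; first by apply: (hs_ball_open hs); exists x, r.
move=> v /= xv; exfalso; move: (lt_le_trans xv r0).
by rewrite ltNge dist_ge0.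
Qed.

Lemma measurable_qball x r : measurable (ball x r).
Proof. exact/measurable_qopen/qopen_qball. Qed.

Lemma qopen_bigcup {I : Type} (F : set I) (B : I -> set S) :
  (forall i, F i -> qopen d (B i)) -> qopen d (\bigcup_(i in F) B i).
Proof.
move=> oB x [i Fi Bx]; have [r r0 rB] := oB i Fi x Bx.
by exists r => // y /rB By; exists i.
Qed.

Lemma mu_qball_gt0 x r : 0 < r -> (0 < mu (ball x r))%E.
Proof. by move=> r0; apply: (hs_ball_gt0 hs); exists x, r. Qed.

Lemma mu_qball_lty x r : (mu (ball x r) < +oo)%E.
Proof.
have h s : 0 < s -> (mu (ball x s) < +oo)%E.
  by move=> s0; apply: (hs_ball_fin hs); exists x, s.
apply: (@le_lt_trans _ _ (mu (ball x (Num.max r 1)))).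
  apply: le_measure_set; [exact: measurable_qball|exact: measurable_qball|].
  by apply: qball_subset; rewrite le_max lexx.
by apply: h; rewrite lt_max ltr01 orbT.
Qed.

Lemma mu_qballE x r : mu (ball x r) = (vol x r)%:E.
Proof. by rewrite fineK// ge0_fin_numE//; exact: mu_qball_lty. Qed.

Lemma vol_gt0 x r : 0 < r -> 0 < vol x r.
Proof. by move=> r0; rewrite fine_gt0// mu_qball_gt0//= mu_qball_lty. Qed.

Lemma vol_le x y r s : ball x r `<=` ball y s -> vol x r <= vol y s.
Proof.
move=> xy; rewrite -lee_fin -!mu_qballE.
by apply: le_measure_set => //; exact: measurable_qball.
Qed.

Lemma vol_doubling n x r : 0 < r -> vol x (2 ^+ n * r) <= Cmu ^+ n * vol x r.
Proof.
move=> r0; elim: n => [|n IH]; first by rewrite !expr0 !mul1r.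
have [dbl _] := hs_doubling hs.
have dn : vol x (2 * (2 ^+ n * r)) <= Cmu * vol x (2 ^+ n * r).
  by rewrite -lee_fin EFinM -!mu_qballE; apply: dbl; rewrite mulr_gt0// exprn_gt0.
have C0 : 0 <= Cmu.
  have p : 0 < vol x (2 * (2 ^+ n * r)).
    by rewrite vol_gt0// !mulr_gt0// exprn_gt0.
  have q : 0 < vol x (2 ^+ n * r) by rewrite vol_gt0// mulr_gt0// exprn_gt0.
  by rewrite -(pmulr_lge0 _ q); exact: le_trans (ltW p) dn.
by rewrite !exprS -!mulrA; apply: le_trans dn _; rewrite ler_wpM2l.
Qed.

(** ** Averages and maximal functions *)

Lemma ball_avgE f x r : 0 < r -> ball_avg mu f (ball x r) =
  ((vol x r)^-1%:E * \int[mu]_(y in ball x r) f y)%E.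
Proof. by move=> r0; rewrite /ball_avg {1}mu_qballE inver gt_eqF// vol_gt0. Qed.

Lemma ball_avg_gt f x r (t : R) : 0 < r ->
  (t%:E < ball_avg mu f (ball x r))%E =
  ((t * vol x r)%:E < \int[mu]_(y in ball x r) f y)%E.
Proof. by move=> r0; rewrite ball_avgE// lte_pdivlMl ?vol_gt0// -EFinM mulrC. Qed.

Lemma ball_avg_le f x r (t : R) : 0 < r ->
  (ball_avg mu f (ball x r) <= t%:E)%E =
  (\int[mu]_(y in ball x r) f y <= (t * vol x r)%:E)%E.
Proof. by move=> r0; rewrite ball_avgE// lee_pdivrMl ?vol_gt0// -EFinM mulrC. Qed.

Lemma ge0_le_integral_qball f x y r s : measurable_fun setT f ->
    (forall z, 0 <= f z)%E -> ball x r `<=` ball y s ->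
  (\int[mu]_(z in ball x r) f z <= \int[mu]_(z in ball y s) f z)%E.
Proof.
move=> mf f0; apply: ge0_subset_integral => //; try exact: measurable_qball.
exact: measurable_funTS.
Qed.

(** Restricting the radii makes the selection of almost maximal balls
    possible and localises the maximal function. *)
Definition lmaximal (r0 : R) (f : S -> \bar R) (x : S) : \bar R :=
  ereal_sup [set ball_avg mu f B | B in
    [set B | exists y r, [/\ 0 < r <= r0, B = ball y r & B x]]].

Lemma lmaximal_ge r0 f x y r : 0 < r <= r0 -> d y x < r ->
  (ball_avg mu f (ball y r) <= lmaximal r0 f x)%E.
Proof.
by move=> r0r yx; apply: ereal_sup_ubound; exists (ball y r) => //; exists y, r.
Qed.

Lemma lmaximal_gt r0 f x (t : \bar R) : (t < lmaximal r0 f x)%E ->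
  exists y r, [/\ 0 < r <= r0, d y x < r & (t < ball_avg mu f (ball y r))%E].
Proof. by move=> /ereal_sup_gt[_ [B [y [r [r0r -> yx]]] <-] tB]; exists y, r. Qed.

Lemma lmaximal_le r0 f x (t : \bar R) :
  (forall y r, 0 < r <= r0 -> d y x < r ->
    (ball_avg mu f (ball y r) <= t)%E) -> (lmaximal r0 f x <= t)%E.
Proof.
by move=> h; apply: ge_ereal_sup => _ [B [y [r [r0r -> yx]]] <-]; exact: h.
Qed.

Lemma ball_avg_ge0 f B : (forall z, 0 <= f z)%E -> (0 <= ball_avg mu f B)%E.
Proof.
by move=> f0; rewrite mule_ge0 ?inve_ge0//; apply: integral_ge0 => z _.
Qed.

Lemma lmaximal_ge0 r0 f x : 0 < r0 -> (forall z, 0 <= f z)%E ->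
  (0 <= lmaximal r0 f x)%E.
Proof.
move=> r0p f0; apply: le_trans (@lmaximal_ge r0 f x x r0 _ _).
- exact: ball_avg_ge0.
- by rewrite r0p lexx.
- by rewrite distxx.
Qed.

Lemma qopen_lmaximal_gt r0 f (t : \bar R) :
  qopen d [set x | (t < lmaximal r0 f x)%E].
Proof.
move=> x /= /lmaximal_gt[y [r [r0r yx tB]]].
have [s s0 sB] := @qopen_qball y r x yx.
by exists s => // z /sB yz; apply: lt_le_trans tB _; exact: lmaximal_ge.
Qed.

Lemma measurable_lsc (f : S -> \bar R) :
  (forall t : R, qopen d [set x | (t%:E < f x)%E]) -> measurable_fun setT f.
Proof.
move=> of_; apply: (measurability _ (ErealGenOInfty.measurableE R)).
move=> _ [_ [r ->] <-]; rewrite setTI.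
rewrite (_ : _ @^-1` _ = [set x | (r%:E < f x)%E]).
  exact/measurable_qopen/of_.
by apply/seteqP; split => x /=; rewrite in_itv/= andbT.
Qed.

Lemma measurable_lmaximal r0 f : measurable_fun setT (lmaximal r0 f).
Proof. by apply: measurable_lsc => t; exact: qopen_lmaximal_gt. Qed.

Lemma maximal_gt f x (t : \bar R) : (t < maximal d mu f x)%E ->
  exists y r, [/\ 0 < r, d y x < r & (t < ball_avg mu (abse \o f) (ball y r))%E].
Proof. by move=> /ereal_sup_gt[_ [B [[y [r [r0 ->]] yx]] <-] tB]; exists y, r. Qed.

Lemma maximal_ge f x y r : 0 < r -> d y x < r ->
  (ball_avg mu (abse \o f) (ball y r) <= maximal d mu f x)%E.
Proof.
move=> r0 yx; apply: ereal_sup_ubound; exists (ball y r) => //; split => //.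
by exists y, r.
Qed.

Lemma maximal_ge0 f x : (0 <= maximal d mu f x)%E.
Proof.
apply: le_trans (@maximal_ge f x x 1 ltr01 _); last by rewrite distxx.
by apply: ball_avg_ge0 => z; exact: abse_ge0.
Qed.

Lemma measurable_maximal f : measurable_fun setT (maximal d mu f).
Proof.
apply: measurable_lsc => t x /= /maximal_gt[y [r [r0 yx tB]]].
have [s s0 sB] := @qopen_qball y r x yx.
by exists s => // z /sB yz; apply: lt_le_trans tB _; exact: maximal_ge.
Qed.

(** ** A covering inequality *)

(* Dilated by this factor, a ball contains every ball of at most twice its
   radius that meets it. *)
Let dilation : R := kappa * (4 * kappa + 1).

Lemma meeting_qball_subset x y r s : ball x r `&` ball y s !=set0 ->
  r <= 2 * s -> ball x r `<=` ball y (dilation * s).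
Proof.
move=> [z [xz yz]] rs; have k1 := kappa_ge1; have k0 := lt_le_trans ltr01 k1.
have s0 : 0 < s by apply: le_lt_trans yz; exact: dist_ge0.
have yx : d y x <= kappa * (s + r).
  by apply: ltW; apply: dist_triangle_lt yz _; rewrite distC.
move=> v /= xv.
have zv : d z v < kappa * (4 * s).
  apply: lt_le_trans (_ : kappa * (r + r) <= _).
    by apply: (@dist_triangle_lt x) => //; rewrite distC.
  by rewrite ler_pM2l//; lra.
rewrite /qball/=; apply: lt_le_trans (dist_triangle_lt yz zv) _.
by rewrite le_eqVlt; apply/orP; left; apply/eqP; rewrite /dilation; ring.
Qed.

(** A bound between integrals over a dilated ball and over the ball itself
    passes to the union of the balls, because Vitali's selection covers the
    union by dilations of disjoint balls. *)
Lemma vitali_integral (F : set (S * R)) (M c : R) (Om V : set S)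
    (f g : S -> \bar R) :
    (forall b, F b -> 0 < b.2 <= M) ->
    measurable_fun setT f -> (forall x, 0 <= f x)%E ->
    measurable_fun setT g -> (forall x, 0 <= g x)%E ->
    measurable Om -> measurable V ->
    Om `<=` \bigcup_(b in F) ball b.1 b.2 ->
    (forall b, F b -> ball b.1 b.2 `<=` V) -> 0 <= c ->
    (forall b, F b -> \int[mu]_(x in ball b.1 (dilation * b.2)) f x <=
       c%:E * \int[mu]_(x in ball b.1 b.2) g x)%E ->
  (\int[mu]_(x in Om) f x <= c%:E * \int[mu]_(x in V) g x)%E.
Proof.
move=> FM mf f0 mg g0 mOm mV OmF FV c0 fg.
pose B (b : S * R) := ball b.1 b.2; pose L (b : S * R) := ball b.1 (dilation * b.2).
have B0 b : F b -> B b !=set0.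
  by move=> /FM/andP[b0 _]; exists b.1; exact: qball_center.
have [G [GF GB GS]] := @vitali_selection R _ _ B snd F M FM B0.
have cG : countable G.
  have [->|[b0 Gb0]] := set0_or_nonempty G; first exact: countable0.
  apply: (@countable_trivIset_measure_gt0 R _ _ mu _ G B
    (fun n => ball b0.1 n%:R)) => //.
  - by move=> b _; exact: measurable_qball.
  - by move=> b /GF/FM/andP[b0p _]; exact: mu_qball_gt0.
  - by move=> n; exact: measurable_qball.
  - by move=> n; exact: mu_qball_lty.
  - move=> b _; exists (Num.truncn (kappa * (d b0.1 b.1 + b.2))).+1.
    by apply: (@qball_subset_center _ _ _ (d b0.1 b.1)) => //; exact/ltW/truncnS_gt.
have /countable_injP[h hinj] := cG.
(* Indexing by natural numbers: the n-th set is the ball of code n, or empty. *)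
pose Bn n := \bigcup_(b in [set b | G b /\ h b = n]) B b.
pose Ln n := \bigcup_(b in [set b | G b /\ h b = n]) L b.
have BLn n : (Bn n = set0 /\ Ln n = set0) \/
    exists b, [/\ G b, Bn n = B b & Ln n = L b].
  have [e|[b [Gb hb]]] := set0_or_nonempty [set b | G b /\ h b = n].
    by left; rewrite /Bn /Ln e !bigcup_set0.
  right; exists b; rewrite /Bn /Ln (_ : [set b | _] = [set b]) ?bigcup_set1//.
  apply/seteqP; split => [b' /= [Gb' hb']|_ ->//].
  by apply: hinj; rewrite ?inE//= hb hb'.
have mBn n : measurable (Bn n).
  by have [[-> _]//|[b [_ -> _]]] := BLn n; exact: measurable_qball.
have mLn n : measurable (Ln n).
  by have [[_ ->]//|[b [_ _ ->]]] := BLn n; exact: measurable_qball.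
have mfn n : measurable_fun setT (f \_ (Ln n)).
  by apply/(measurable_restrictT _ _).1 => //; exact: measurable_funTS.
have fn0 n x : (0 <= (f \_ (Ln n)) x)%E by apply: erestrict_ge0.
have OmL x : Om x -> exists n, Ln n x.
  move=> /OmF[b Fb bx]; have [b' [Gb' bb' rr']] := GS b Fb.
  by exists (h b'), b' => //; exact: meeting_qball_subset bb' rr' _ bx.
apply: (@le_trans _ _ (\sum_(n <oo) \int[mu]_(x in Ln n) f x)%E).
  under eq_eseriesr do rewrite integral_mkcond.
  rewrite -integral_nneseries// integral_mkcond.
  apply: ge0_le_integral => //.
  - by move=> x _; apply: erestrict_ge0.
  - by apply/(measurable_restrictT _ _).1 => //; exact: measurable_funTS.
  - by apply: ge0_emeasurable_sum => // n x _ _; exact: fn0.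
  - move=> x _; rewrite patchE; case: ifPn => [|_]; last exact: nneseries_ge0.
    rewrite inE => /OmL[n nx].
    rewrite (nneseriesD1 (n := n))//.
    rewrite [in leRHS]patchE mem_set// leeDl//.
    by apply: nneseries_ge0 => k _ _; exact: fn0.
apply: (@le_trans _ _ (\sum_(n <oo) c%:E * \int[mu]_(x in Bn n) g x)%E).
  apply: lee_nneseries => [n _ _|n _]; first exact: integral_ge0.
  have [[-> ->]|[b [Gb -> ->]]] := BLn n; last exact/fg/GF.
  by rewrite !integral_set0 mule0.
rewrite nneseriesZl; last by move=> n _; exact: integral_ge0.
rewrite lee_wpmul2l ?lee_fin// -ge0_integral_bigcup//.
- apply: ge0_subset_integral => //; first exact: bigcup_measurable.
    exact: measurable_funTS.
  apply: bigcup_sub => n _ x [b [Gb _] bx].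
  exact: FV (GF _ Gb) _ bx.
- exact: measurable_funTS.
- move=> n m _ _ [x [[b [Gb <-] bx] [b' [Gb' <-] bx']]].
  by congr h; apply: GB => //; exists x.
Qed.

End balls.
Arguments lmaximal {R disp S} d mu r0 f x.

(** * Stopping balls of a localised maximal function *)

Section stopping.
Context {R : realType} {disp : measure_display} {S : measurableType disp}.
Context {d : S -> S -> R} {mu : {measure set S -> \bar R}} {kappa Cmu : R}.
Context (hs : homogeneous_space d mu kappa Cmu).
Context {K D : R}.
Context (Kkappa : 20 * kappa ^+ 5 <= K) (D2 : 2 <= D).
Context (volK : forall (x : S) (r : R), 0 < r ->
  fine (mu (qball d x (K * r))) <= D * fine (mu (qball d x r))).
Context {sigma : S -> \bar R} (msigma : measurable_fun setT sigma).
Context (sigma0 : forall x, (0 <= sigma x)%E).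
Context (sigma_fin : forall x r, (\int[mu]_(z in qball d x r) sigma z < +oo)%E).
Context (sigma_gt0 : forall (x : S) (r : R), 0 < r ->
  (0 < \int[mu]_(z in qball d x r) sigma z)%E).
Context {A : R} (A1 : 1 <= A).
Context (Ainfty : forall (x : S) (r : R), 0 < r ->
  (\int[mu]_(z in qball d x r) maximal d mu (sigma \_ (qball d x r)) z <=
   A%:E * \int[mu]_(z in qball d x r) sigma z)%E).
Context (x0 : S) {r0 : R} (r0_gt0 : 0 < r0).

Local Notation ball := (qball d).
Local Notation vol x r := (fine (mu (ball x r))).
Local Notation mass x r := (fine (\int[mu]_(z in ball x r) sigma z)%E).

Let k1 : 1 <= kappa := kappa_ge1 hs.
Let k0 : 0 < kappa. Proof. exact: lt_le_trans ltr01 k1. Qed.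
Let D0 : 0 < D. Proof. by apply: lt_le_trans D2. Qed.
Let D1 : 1 <= D. Proof. by apply: le_trans D2; rewrite ler1n. Qed.

Let kpow m n : (m <= n)%N -> kappa ^+ m <= kappa ^+ n.
Proof. by move=> mn; exact: ler_weXn2l. Qed.

Let K20 : 20 <= K.
Proof.
apply: le_trans Kkappa; have := kpow (leq0n 5); rewrite expr0; lra.
Qed.

Let K0 : 0 < K. Proof. by apply: lt_le_trans K20. Qed.

Lemma vol_dilate n x r : 0 < r -> vol x (K ^+ n * r) <= D ^+ n * vol x r.
Proof.
move=> r_gt0; elim: n => [|n IH]; first by rewrite !expr0 !mul1r.
rewrite !exprS -!mulrA; apply: le_trans (volK _ _) _.
  by rewrite mulr_gt0// exprn_gt0.
by rewrite ler_wpM2l// ltW.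
Qed.

Let massE x r : (\int[mu]_(z in ball x r) sigma z = (mass x r)%:E)%E.
Proof. by rewrite fineK// ge0_fin_numE//; exact: integral_ge0. Qed.

Let mass_le x y r s : ball x r `<=` ball y s -> mass x r <= mass y s.
Proof.
by move=> xy; rewrite -lee_fin -!massE; exact: (ge0_le_integral_qball hs).
Qed.

(** ** Neighbourhoods of a ball that stay in a larger ball *)

(** The steps decrease geometrically with ratio [K^-1], which beats the loss
    of a factor [kappa] at each use of the triangle inequality. *)
Definition step i : R := 2 * kappa * r0 / K ^+ i.+1.

Definition grow (rho : R) (E : set S) : set S := \bigcup_(x in E) ball x rho.

(** The smallest index is used first, so that the steps still to come form a
    sequence of the same kind and [chain_near] is a plain induction. *)
Fixpoint chain i n (E : set S) : set S :=
  if n is n'.+1 then chain i.+1 n' (grow (step i) E) else E.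

Lemma chainS i n E : chain i n.+1 E = grow (step (i + n)) (chain i n E).
Proof.
elim: n i E => [|n IH] i E; first by rewrite addn0.
by rewrite -[LHS]/(chain i.+1 n.+1 (grow (step i) E)) IH addSnnS.
Qed.

Lemma step_gt0 i : 0 < step i.
Proof. by rewrite divr_gt0 ?mulr_gt0 ?exprn_gt0. Qed.

Lemma stepS i : 2 * kappa * step i.+1 <= step i.
Proof.
have Kk : 2 * kappa <= K.
  apply: le_trans Kkappa; have := kpow (isT : (1 <= 5)%N); rewrite expr1.
  by have := k0; lra.
have s0 := step_gt0 i.
rewrite /step exprS [K * _ ^+ _]mulrC invfM [leLHS](_ : _ = step i * (2 * kappa / K)).
  by rewrite ger_pMr// ler_pdivrMr// mul1r.
by rewrite /step; ring.
Qed.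

Lemma chain_near i n E v : chain i n E v ->
  exists2 x, E x & d x v < 2 * kappa * step i.
Proof.
elim: n i E => [|n IH] i E; first by exists v => //; rewrite (distxx hs) (mulr_gt0 _ (step_gt0 i))// mulr_gt0.
move=> /IH[y [x Ex xy] yv]; exists x => //.
apply: lt_le_trans (dist_triangle_lt hs xy yv) _.
have -> : 2 * kappa * step i = kappa * (step i + step i) by ring.
by rewrite ler_pM2l// lerD2l stepS.
Qed.

Definition nbhd n := chain 0 n (ball x0 r0).

Lemma nbhdS n : nbhd n.+1 = grow (step n) (nbhd n).
Proof. exact: chainS. Qed.

Lemma nbhd_near n v : nbhd n v -> d x0 v < 2 * kappa * r0.
Proof.
move=> /chain_near[x x0x xv].
apply: lt_le_trans (dist_triangle_lt hs x0x xv) _.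
have -> : 2 * kappa * r0 = kappa * (r0 + r0) by ring.
rewrite ler_pM2l// lerD2l /step expr1 mulrA ler_pdivrMr//.
have -> : 2 * kappa * (2 * kappa * r0) = r0 * (4 * kappa ^+ 2) by ring.
rewrite ler_pM2l//.
have := kpow (isT : (2 <= 5)%N); have := kpow (isT : (0 <= 2)%N).
rewrite expr0; have := Kkappa; lra.
Qed.

Lemma qopen_nbhd n : qopen d (nbhd n).
Proof.
case: n => [|n]; first exact: (qopen_qball hs).
by rewrite nbhdS; apply: qopen_bigcup => x _; exact: (qopen_qball hs).
Qed.

Lemma measurable_nbhd n : measurable (nbhd n).
Proof. exact/(measurable_qopen hs)/qopen_nbhd. Qed.

(** ** Levels *)

Definition mean : R := mass x0 (K * r0) / vol x0 (K * r0).

(** The offset [3] makes [level i] exceed every average over a ball near [x0]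
    whose radius is at least [r0 / K ^ i.+1]: such a ball becomes larger than
    the one defining [mean] after [i + 3] dilations by [K]. *)
Definition level k : R := D ^+ (k + 3) * mean.

Definition superlevel k : set S :=
  [set u | ((level k)%:E < lmaximal d mu r0 sigma u)%E].

Lemma mean_gt0 : 0 < mean.
Proof.
rewrite divr_gt0//; last by rewrite (vol_gt0 hs)// mulr_gt0.
by rewrite fine_gt0// sigma_gt0 ?mulr_gt0//= sigma_fin.
Qed.

Lemma level_gt0 k : 0 < level k.
Proof. by rewrite mulr_gt0 ?exprn_gt0// mean_gt0. Qed.

Lemma level_le i k : (i <= k)%N -> level i <= level k.
Proof.
move=> ik; rewrite ler_wpM2r ?(ltW mean_gt0)//.
by apply: ler_weXn2l => //; rewrite leq_add2r.
Qed.

Lemma levelE k : level k = D ^+ k * level 0.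
Proof. by rewrite /level add0n exprD mulrA. Qed.

Lemma measurable_superlevel k : measurable (superlevel k).
Proof. exact/(measurable_qopen hs)/(qopen_lmaximal_gt hs). Qed.

(** Balls of radius comparable to [r0] have averages comparable to [mean]. *)
Lemma avg_large_ball i y r : d x0 y <= 10 * kappa ^+ 4 * r0 -> 0 < r <= r0 ->
  r0 <= K ^+ i.+1 * r -> mass y r <= level i * vol y r.
Proof.
move=> x0y /andP[r_gt0 rr0] r0r.
have k4 := kpow (isT : (1 <= 5)%N); have k5 := kpow (isT : (5 <= 5)%N).
have sub1 : ball y r `<=` ball x0 (K * r0).
  apply: (qball_subset_center hs (s := 10 * kappa ^+ 4 * r0)) => //.
  have -> : kappa * (10 * kappa ^+ 4 * r0 + r) = 10 * kappa ^+ 5 * r0 + kappa * r.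
    by rewrite exprS; ring.
  have : kappa * r <= kappa ^+ 5 * r0.
    by rewrite expr1 in k4; apply: ler_pM; rewrite // ltW.
  have : 20 * kappa ^+ 5 * r0 <= K * r0 by rewrite ler_pM2r.
  have : 0 <= kappa ^+ 5 * r0 by rewrite mulr_ge0 ?exprn_ge0 ?ltW.
  lra.
have sub2 : ball x0 (K * r0) `<=` ball y (K ^+ (i + 3) * r).
  apply: (@subset_trans _ (ball y (K ^+ 2 * r0))); last first.
    apply: qball_subset; rewrite addnC addSnnS exprD -mulrA.
    by rewrite ler_pM2l// exprn_gt0.
  apply: (qball_subset_center hs (s := 10 * kappa ^+ 4 * r0)).
    by rewrite (distC hs).
  have -> : kappa * (10 * kappa ^+ 4 * r0 + K * r0) = (10 * kappa ^+ 5 + kappa * K) * r0.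
    by rewrite exprS; ring.
  rewrite ler_pM2r//.
  have : kappa * K <= K / 20 * K by rewrite ler_pM2r//; rewrite expr1 in k4; move: Kkappa k4 k0; lra.
  have : K * 20 <= K * K by rewrite ler_pM2l.
  rewrite expr2; have := Kkappa; have := K0; lra.
have vol0 : 0 < vol x0 (K * r0) by rewrite (vol_gt0 hs)// mulr_gt0.
apply: le_trans (mass_le sub1) _.
rewrite -[leLHS](divfK (lt0r_neq0 vol0)) -/mean mulrC /level mulrAC.
rewrite ler_pM2r ?mean_gt0//.
by apply: le_trans (vol_le hs sub2) _; exact: vol_dilate.
Qed.

(** ** Stopping balls *)

(** The radius is almost maximal among the balls around some point of the
    neighbourhood whose average exceeds the level. *)
Definition stopping i k : set (S * R) := [set b | [/\ 0 < b.2 <= r0,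
  ((level k)%:E < ball_avg mu sigma (ball b.1 b.2))%E &
  exists x, [/\ nbhd i x, ball b.1 b.2 x &
    forall y r, 2 * b.2 <= r <= r0 -> d y x < r ->
      (ball_avg mu sigma (ball y r) <= (level k)%:E)%E]]].

Lemma stopping_cover i k :
  nbhd i `&` superlevel k `<=` \bigcup_(b in stopping i k) ball b.1 b.2.
Proof.
move=> x [Ux /lmaximal_gt[y1 [r1 [/andP[r1p r1r0] y1x t1]]]].
pose E := [set r | exists y, [/\ 0 < r <= r0, d y x < r &
  ((level k)%:E < ball_avg mu sigma (ball y r))%E]].
have hE : has_sup E.
  split; first by exists r1, y1; rewrite r1p.
  by exists r0 => r [y [/andP[]]].
have supE : 0 < sup E.
  by apply: (lt_le_trans r1p); apply: ub_le_sup; [exact: hE.2|exists y1; rewrite r1p].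
have [|r [y [/andP[rp rr0] yx tr]] supr] := @sup_adherent _ _ (sup E / 2) _ hE.
  by rewrite divr_gt0.
exists (y, r) => //; split => /=; [by rewrite rp| by []|].
exists x; split => // z s /andP[rs sr0] zx; rewrite leNgt; apply/negP => ts.
suff : s <= sup E by lra.
apply: ub_le_sup; first exact: hE.2.
by exists z; split => //; rewrite sr0 andbT; lra.
Qed.

(** A radius larger than [r0 / K ^ i.+1] would force the average below
    [level i]. *)
Lemma stopping_small i k b : (i <= k)%N -> stopping i k b ->
  K ^+ i.+1 * b.2 < r0.
Proof.
move=> ik [/andP[bp br0] tb [x [Ux bx _]]]; rewrite ltNge; apply/negP => r0b.
move: tb; apply/negP; rewrite -leNgt (ball_avg_le hs)// massE lee_fin.
apply: (@le_trans _ _ (level i * vol b.1 b.2)); last first.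
  by rewrite ler_wpM2r ?level_le// ltW// (vol_gt0 hs).
apply: avg_large_ball => //; last by rewrite bp.
apply: ltW; apply: lt_le_trans (_ : kappa * (2 * kappa * r0 + r0) <= _).
  by apply: (dist_triangle_lt hs (nbhd_near Ux)); rewrite (distC hs);
    apply: lt_le_trans bx br0.
have -> : kappa * (2 * kappa * r0 + r0) = (2 * kappa ^+ 2 + kappa) * r0 by ring.
rewrite ler_pM2r//.
have := kpow (isT : (1 <= 4)%N); have := kpow (isT : (2 <= 4)%N).
have := exprn_gt0 4 k0; rewrite expr1; lra.
Qed.

(** Small stopping balls move from one neighbourhood only into the next. *)
Lemma stopping_subset i k b : (i <= k)%N -> stopping i k b ->
  ball b.1 b.2 `<=` nbhd i.+1 `&` superlevel k.
Proof.
move=> ik Fb; have small := stopping_small ik Fb.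
have [/andP[bp br0] tb [x [Ux bx _]]] := Fb => u bu; split.
  rewrite nbhdS; exists x => //; rewrite /qball/=.
  apply: lt_le_trans (_ : kappa * (b.2 + b.2) <= _).
    by apply: (dist_triangle_lt hs) bu; rewrite (distC hs).
  rewrite /step ler_pdivlMr ?exprn_gt0//.
  rewrite [leLHS](_ : _ = 2 * kappa * (K ^+ i.+1 * b.2)); last by ring.
  by rewrite ler_pM2l ?mulr_gt0// ltW.
by apply: lt_le_trans tb _; apply: lmaximal_ge; rewrite ?bp.
Qed.

Lemma stopping_smallK i k b : (i <= k)%N -> stopping i k b -> K * b.2 < r0.
Proof.
move=> ik Fb; apply: le_lt_trans (stopping_small ik Fb).
have [/andP[bp _] _ _] := Fb.
rewrite ler_pM2r// exprS ler_peMr ?(ltW K0)//.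
by apply: exprn_ege1; apply: le_trans K20; rewrite ler1n.
Qed.

(** The dilated ball is too large for its average to exceed the level. *)
Lemma stopping_mass i k b : (i <= k)%N -> stopping i k b ->
  mass b.1 (K * b.2) <= level k * D * vol b.1 b.2.
Proof.
move=> ik Fb; have small := stopping_smallK ik Fb.
have [/andP[bp br0] tb [x [Ux bx stop]]] := Fb.
have Kb : 0 < K * b.2 by rewrite mulr_gt0.
have b2 : 2 * b.2 <= K * b.2 by rewrite ler_pM2r//; move: K20; lra.
have := stop b.1 (K * b.2); rewrite (ball_avg_le hs)// massE lee_fin => H.
apply: le_trans (H _ _) _.
- by rewrite b2 ltW.
- by apply: lt_le_trans bx _; move: b2 bp; lra.
- by rewrite -mulrA ler_pM2l ?level_gt0// volK.
Qed.


Local Notation dilation := (kappa * (4 * kappa + 1)).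

Let dilation_le : kappa * (kappa * (dilation + 1) + 1) <= K.
Proof.
have := kpow (isT : (1 <= 5)%N); have := kpow (isT : (2 <= 5)%N).
have := kpow (isT : (3 <= 5)%N); have := kpow (isT : (4 <= 5)%N).
have -> : kappa * (kappa * (dilation + 1) + 1) =
  4 * kappa ^+ 4 + kappa ^+ 3 + kappa ^+ 2 + kappa by ring.
have := exprn_gt0 5 k0; rewrite expr1; move: Kkappa; lra.
Qed.

(** Small balls around a point near a stopping ball only see [sigma] on its
    dilation; large ones can be dilated to contain the point where the stopping
    ball was chosen, unless they are of radius comparable to [r0]. *)
Lemma lmaximal_near_stopping i k b u : (i <= k)%N -> stopping i k b ->
    ball b.1 (dilation * b.2) u ->
  (lmaximal d mu r0 sigma u <=
   maximal d mu (sigma \_ (ball b.1 (K * b.2))) u + (D * level k)%:E)%E.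
Proof.
move=> ik Fb bu; have small := stopping_smallK ik Fb.
have [/andP[bp br0] tb [x [Ux bx stop]]] := Fb.
apply: lmaximal_le => z s /andP[sp sr0] zu.
have [sb|bs] := leP s b.2.
  have sub : ball z s `<=` ball b.1 (K * b.2).
    apply: (qball_subset_center hs (s := kappa * (dilation * b.2 + s))).
      by apply: ltW; apply: (dist_triangle_lt hs) bu _; rewrite (distC hs).
    apply: le_trans (_ : kappa * (kappa * (dilation + 1) + 1) * b.2 <= _).
      have -> : kappa * (kappa * (dilation + 1) + 1) * b.2 =
        kappa * (kappa * (dilation * b.2 + b.2) + b.2) by ring.
      by rewrite ler_pM2l// lerD// ler_pM2l// lerD2l.
    by rewrite ler_pM2r// dilation_le.
  apply: le_trans (_ : maximal d mu (sigma \_ (ball b.1 (K * b.2))) u <= _)%E.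
    apply: le_trans (maximal_ge _ sp zu).
    rewrite /ball_avg le_eqVlt; apply/orP; left; apply/eqP; congr (_ * _)%E.
    apply: eq_integral => v; rewrite inE => /sub bv.
    by rewrite /= patchE mem_set// gee0_abs.
  by rewrite leeDl// lee_fin mulr_ge0 ?(ltW D0) ?(ltW (level_gt0 k)).
apply: (@le_trans _ _ (D * level k)%:E); last first.
  by rewrite leeDr//; exact: (maximal_ge0 hs).
rewrite (ball_avg_le hs)// massE lee_fin.
have [Ks|Ks] := leP (K * s) r0.
  have zx : d z x < K * s.
    apply: lt_le_trans (_ : kappa * (kappa * (dilation + 1) + 1) * s <= _); last first.
      by rewrite ler_pM2r// dilation_le.
    have ux : d u x < kappa * ((dilation + 1) * s).
      apply: lt_le_trans (_ : kappa * (dilation * b.2 + b.2) <= _).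
        by apply: (dist_triangle_lt hs (z := b.1)) => //; rewrite (distC hs).
      have -> : dilation * b.2 + b.2 = (dilation + 1) * b.2 by ring.
      rewrite ler_pM2l// ler_pM2l ?(ltW bs)//.
      by rewrite addr_gt0// mulr_gt0// addr_gt0// mulr_gt0.
    have -> : kappa * (kappa * (dilation + 1) + 1) * s =
        kappa * (s + kappa * ((dilation + 1) * s)) by ring.
    exact: dist_triangle_lt hs _ _ _ _ _ zu ux.
  have Ks0 : 0 < K * s by rewrite mulr_gt0.
  have := stop z (K * s); rewrite (ball_avg_le hs)// massE lee_fin => H.
  apply: le_trans (_ : mass z s <= mass z (K * s)) _.
    apply: mass_le; apply: qball_subset; rewrite ler_peMl ?(ltW sp)//.
    by move: K20; lra.
  apply: le_trans (H _ zx) _.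
    rewrite Ks andbT; apply: le_trans (_ : K * b.2 <= _); last first.
      by rewrite ler_pM2l// ltW.
    by rewrite ler_pM2r//; move: K20; lra.
  by rewrite (mulrC D) -(mulrA (level k) D) ler_pM2l ?level_gt0// volK.
apply: le_trans (_ : level 0 * vol z s <= _).
  apply: avg_large_ball; rewrite ?sp ?sr0 ?expr1 ?(ltW Ks)//.
  have by0 : d x0 b.1 < kappa * (2 * kappa * r0 + r0).
    apply: (dist_triangle_lt hs (nbhd_near Ux)); rewrite (distC hs).
    exact: lt_le_trans bx br0.
  have bz : d b.1 z < kappa * (r0 + r0).
    apply: (dist_triangle_lt hs (z := u)); last first.
      by rewrite (distC hs); exact: lt_le_trans zu sr0.
    apply: lt_trans bu _; apply: le_lt_trans small.
    rewrite ler_pM2r//.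
    have := kpow (isT : (1 <= 5)%N); have := kpow (isT : (2 <= 5)%N).
    have -> : dilation = 4 * kappa ^+ 2 + kappa by ring.
    by have := exprn_gt0 5 k0; rewrite expr1; move: Kkappa; lra.
  apply: ltW; apply: lt_le_trans (dist_triangle_lt hs by0 bz) _.
  have -> : kappa * (kappa * (2 * kappa * r0 + r0) + kappa * (r0 + r0)) =
    (2 * kappa ^+ 3 + 3 * kappa ^+ 2) * r0 by ring.
  rewrite ler_pM2r//.
  have := kpow (isT : (2 <= 4)%N); have := kpow (isT : (3 <= 4)%N).
  by have := exprn_gt0 4 k0; lra.
rewrite ler_wpM2r ?(ltW (vol_gt0 hs _ sp))//.
apply: le_trans (level_le (leq0n k)) _.
by rewrite ler_peMl// ltW// level_gt0.
Qed.

(** Integrating the previous bound, the A_infty constant controls the first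
    term through the mass of the dilated ball, which is about the level times
    its measure. *)
Lemma stopping_lmaximal i k b : (i <= k)%N -> stopping i k b ->
  (\int[mu]_(u in ball b.1 (dilation * b.2)) lmaximal d mu r0 sigma u <=
   (2 * D ^+ 2 * A * level k)%:E * mu (ball b.1 b.2))%E.
Proof.
move=> ik Fb; have [/andP[bp br0] _ _] := Fb.
have mM := measurable_maximal hs (sigma \_ (ball b.1 (K * b.2))).
have M0 := maximal_ge0 hs (sigma \_ (ball b.1 (K * b.2))).
have Kb : 0 < K * b.2 by rewrite mulr_gt0.
have lam0 : 0 < dilation by rewrite mulr_gt0// addr_gt0// mulr_gt0.
have lamK : dilation <= K.
  apply: le_trans dilation_le; have h : 1 <= kappa * kappa by rewrite mulr_ege1.
  have : dilation <= kappa * kappa * dilation by rewrite ler_peMl// ltW.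
  have : kappa * (kappa * (dilation + 1) + 1) =
    kappa * kappa * dilation + kappa * kappa + kappa by ring.
  by move: k0 h; lra.
have mball r : measurable (ball b.1 r) by exact: (measurable_qball hs).
apply: (@le_trans _ _ (\int[mu]_(u in ball b.1 (dilation * b.2))
    (maximal d mu (sigma \_ (ball b.1 (K * b.2))) u + (D * level k)%:E))%E).
  apply: ge0_le_integral => //.
  - by move=> u _; exact: (lmaximal_ge0 hs).
  - by apply: measurable_funTS; exact: (measurable_lmaximal hs).
  - by apply: emeasurable_funD => //; exact: measurable_funTS.
  - by move=> u bu; exact: lmaximal_near_stopping ik Fb bu.
have c0 : 0 <= D * level k by rewrite mulr_ge0 ?(ltW D0) ?(ltW (level_gt0 k)).
rewrite ge0_integralD//; last exact: measurable_funTS.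
rewrite integral_cst//.
apply: (@le_trans _ _ ((A * mass b.1 (K * b.2))%:E + (D * level k * vol b.1 (K * b.2))%:E)%E).
  apply: leeD.
    apply: le_trans (_ : \int[mu]_(x in ball b.1 (K * b.2))
        maximal d mu (sigma \_ (ball b.1 (K * b.2))) x <= _)%E.
      apply: (ge0_le_integral_qball hs) => //.
      by apply: qball_subset; rewrite ler_pM2r.
    by rewrite EFinM -massE; exact: Ainfty.
  rewrite [X in (_ * X)%E](mu_qballE hs) -EFinM lee_fin ler_wpM2l//.
  by apply: (vol_le hs); apply: qball_subset; rewrite ler_pM2r.
rewrite [X in (_ * X)%E](mu_qballE hs) -EFinM -EFinD lee_fin.
have v0 := vol_gt0 hs b.1 bp; have t0 := level_gt0 k.
apply: le_trans (_ : A * (level k * D * vol b.1 b.2) + D * level k * (D * vol b.1 b.2) <= _).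
  apply: lerD; first by rewrite ler_wpM2l ?(stopping_mass ik Fb)// (le_trans ler01).
  by rewrite ler_wpM2l// volK.
have -> : 2 * D ^+ 2 * A * level k * vol b.1 b.2 =
  (D * A + D * A) * (D * (level k * vol b.1 b.2)) by ring.
have -> : A * (level k * D * vol b.1 b.2) + D * level k * (D * vol b.1 b.2) =
  (A + D) * (D * (level k * vol b.1 b.2)) by ring.
apply: ler_wpM2r; first exact: mulr_ge0 (ltW D0) (mulr_ge0 (ltW t0) (ltW v0)).
apply: lerD; first by rewrite ler_peMl// (le_trans ler01).
by rewrite ler_peMr// ltW.
Qed.

Let integral_superlevel f c i k : (i <= k)%N ->
    measurable_fun setT f -> (forall x, 0 <= f x)%E -> 0 <= c ->
    (forall b, stopping i k b ->
      \int[mu]_(x in ball b.1 (dilation * b.2)) f x <= c%:E * mu (ball b.1 b.2))%E ->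
  (\int[mu]_(x in nbhd i `&` superlevel k) f x <=
   c%:E * mu (nbhd i.+1 `&` superlevel k))%E.
Proof.
move=> ik mf f0 c0 H.
have m1 j : measurable (nbhd j `&` superlevel k).
  by apply: measurableI; [exact: measurable_nbhd|exact: measurable_superlevel].
rewrite -[X in (_ <= _ * X)%E]mul1e -integral_cst//.
apply: (vitali_integral hs (F := stopping i k) (M := r0)) => //.
- by move=> b [].
- exact: stopping_cover.
- by move=> b; exact: stopping_subset.
- by move=> b /H; rewrite integral_cst ?mul1e//; exact: (measurable_qball hs).
Qed.

(** The bounds on stopping balls add up, and the stopping balls lie in the next
    neighbourhood. *)
Lemma integral_lmaximal_superlevel i k : (i <= k)%N ->
  (\int[mu]_(x in nbhd i `&` superlevel k) lmaximal d mu r0 sigma x <=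
   (2 * D ^+ 2 * A * level k)%:E * mu (nbhd i.+1 `&` superlevel k))%E.
Proof.
move=> ik; apply: integral_superlevel => //.
- exact: (measurable_lmaximal hs).
- by move=> x; exact: (lmaximal_ge0 hs).
- apply: mulr_ge0 (ltW (level_gt0 k)).
  by rewrite !mulr_ge0 ?exprn_ge0 ?(ltW D0)// (le_trans ler01 A1).
- by move=> b; exact: stopping_lmaximal.
Qed.

Lemma integral_superlevel_le i k : (i <= k)%N ->
  (\int[mu]_(x in nbhd i `&` superlevel k) sigma x <=
   (D * level k)%:E * mu (nbhd i.+1 `&` superlevel k))%E.
Proof.
move=> ik; apply: integral_superlevel => //.
  by rewrite mulr_ge0 ?(ltW D0) ?(ltW (level_gt0 k)).
move=> b Fb; have [/andP[bp _] _ _] := Fb.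
apply: le_trans (_ : (mass b.1 (K * b.2))%:E <= _)%E.
  rewrite -massE; apply: (ge0_le_integral_qball hs) => //.
  apply: qball_subset; rewrite ler_pM2r//; move: Kkappa.
  have := kpow (isT : (1 <= 5)%N); have := kpow (isT : (2 <= 5)%N).
  have -> : dilation = 4 * kappa ^+ 2 + kappa by ring.
  by have := exprn_gt0 5 k0; rewrite expr1; lra.
rewrite [X in (_ * X)%E](mu_qballE hs) -EFinM lee_fin (mulrC D).
exact: stopping_mass ik Fb.
Qed.

(** ** The reverse Hoelder inequality *)

Local Notation lmax := (lmaximal d mu r0 sigma).

(** Averages over shrinking balls converge to [sigma] almost everywhere. *)
Lemma sigma_le_lmaximal :
  {ae mu, forall x, ball x0 r0 x -> (sigma x <= lmax x)%E}.
Proof.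
have mball x r : measurable (ball x r) by exact: (measurable_qball hs).
pose f := fine \o sigma.
have mf : measurable_fun setT f by exact: measurableT_comp.
have isigma x r : mu.-integrable (ball x r) sigma.
  apply/integrableP; split; first exact: measurable_funTS.
  by under eq_integral => z _ do rewrite gee0_abs//.
have fsigma z : (`|(f z)%:E| <= sigma z)%E.
  by rewrite /f/=; case: (sigma z) (sigma0 z) => [s s0| |]//=;
    rewrite ?leey// lee_fin ger0_norm.
have fi B : qballs d B -> mu.-integrable B (EFin \o f).
  move=> [x [r [_ ->]]]; apply: le_integrable (isigma x r) => //.
    by apply/measurable_EFinP; exact: measurable_funTS.
  by move=> z _; rewrite [leRHS]gee0_abs//; exact: fsigma.
have diff := hs_differentiation hs mf fi.
have fin := integrable_ae (mball x0 r0) (isigma x0 r0).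
apply: filterS2 diff fin => x cvgx finx bx; rewrite -(fineK (finx bx)) -/(f x).
case lx : (lmax x) => [M| |]; [|by rewrite leey|]; last first.
  by have := lmaximal_ge0 hs x r0_gt0 sigma0; rewrite lx.
rewrite lee_fin; apply: (cvgr_to_le cvgx); near=> r.
have r_gt0 : 0 < r by near: r; exact: nbhs_right_gt.
have rr0 : r <= r0 by near: r; exact: nbhs_right_le.
have : (ball_avg mu sigma (ball x r) <= M%:E)%E.
  rewrite -lx; apply: lmaximal_ge; first by rewrite r_gt0.
  by rewrite (distxx hs).
rewrite (ball_avg_le hs)// massE lee_fin => massM.
rewrite ler_pdivrMl ?(vol_gt0 hs)//; apply: (@le_trans _ _ (mass x r)); last by rewrite mulrC.
rewrite -lee_fin /Rintegral fineK; last first.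
  by apply: integrable_fin_num => //; apply: fi; exists x, r.
rewrite -massE; apply: ge0_le_integral => //.
- by move=> z _; rewrite lee_fin fine_ge0.
- by apply/measurable_EFinP; exact: measurable_funTS.
- exact: measurable_funTS.
- by move=> z _; apply: le_trans (fsigma z); exact: lee_abs.
Unshelve. all: by end_near. Qed.

Let m1 i k : measurable (nbhd i `&` superlevel k).
Proof. by apply: measurableI; [exact: measurable_nbhd|exact: measurable_superlevel]. Qed.

Let g i k := fine (mu (nbhd i `&` superlevel k)).
Let V := vol x0 (2 * kappa * r0).

Let gE i k : mu (nbhd i `&` superlevel k) = (g i k)%:E /\ 0 <= g i k <= V.
Proof.
have le : (mu (nbhd i `&` superlevel k) <= V%:E)%E.
  rewrite -(mu_qballE hs); apply: le_measure_set => //.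
    exact: (measurable_qball hs).
  by move=> u [/nbhd_near].
have fin : mu (nbhd i `&` superlevel k) \is a fin_num.
  by rewrite ge0_fin_numE//; apply: le_lt_trans le _; rewrite ltry.
by split; rewrite ?fineK// fine_ge0//= -lee_fin fineK.
Qed.

Let W := A * mass x0 (K * r0).

Lemma integral_lmaximal_nbhd i : (\int[mu]_(u in nbhd i) lmax u <= W%:E)%E.
Proof.
have Kr0 : 0 < K * r0 by rewrite mulr_gt0.
have near_sub u y r : nbhd i u -> 0 < r <= r0 -> d y u < r ->
    ball y r `<=` ball x0 (K * r0).
  move=> Uu /andP[rp rr0] yu.
  apply: (qball_subset_center hs (s := kappa * (2 * kappa * r0 + r))).
    by apply: ltW; apply: (dist_triangle_lt hs (nbhd_near Uu)); rewrite (distC hs).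
  apply: (@le_trans _ _ (kappa * (kappa * (2 * kappa * r0 + r0) + r0))).
    by rewrite ler_pM2l// lerD// ler_pM2l// lerD2l.
  have -> : kappa * (kappa * (2 * kappa * r0 + r0) + r0) =
    (2 * kappa ^+ 3 + kappa ^+ 2 + kappa) * r0 by ring.
  rewrite ler_pM2r//.
  have := kpow (isT : (1 <= 5)%N); have := kpow (isT : (2 <= 5)%N).
  have := kpow (isT : (3 <= 5)%N).
  by have := exprn_gt0 5 k0; rewrite expr1; move: Kkappa; lra.
rewrite /W EFinM -massE; apply: le_trans (Ainfty _ Kr0).
have mball x r : measurable (ball x r) by exact: (measurable_qball hs).
apply: (@le_trans _ _ (\int[mu]_(u in nbhd i) maximal d mu (sigma \_ (ball x0 (K * r0))) u)%E).
  apply: ge0_le_integral.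
  - exact: measurable_nbhd.
  - by move=> u _; exact: (lmaximal_ge0 hs).
  - by apply: measurable_funTS; exact: (measurable_lmaximal hs).
  - by apply: measurable_funTS; exact: (measurable_maximal hs).
  - move=> u Uu; apply: lmaximal_le => y r rr yu.
    have rp : 0 < r by case/andP: rr.
    apply: le_trans (maximal_ge _ rp yu).
    rewrite /ball_avg le_eqVlt; apply/orP; left; apply/eqP; congr (_ * _)%E.
    apply: eq_integral => v; rewrite inE => /(near_sub _ _ _ Uu rr yu) bv.
    by rewrite /= patchE mem_set// gee0_abs.
apply: ge0_subset_integral => //.
- exact: measurable_nbhd.
- by apply: measurable_funTS; exact: (measurable_maximal hs).
- by move=> u _; exact: (maximal_ge0 hs).
- move=> u /nbhd_near; rewrite /qball/= => /lt_le_trans; apply.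
  rewrite ler_pM2r//; have := kpow (isT : (1 <= 5)%N).
  by have := exprn_gt0 5 k0; rewrite expr1; move: Kkappa; lra.
Qed.

Let m i k := fine (\int[mu]_(x in nbhd i `&` superlevel k) lmax x)%E.

Let mlmax E : measurable_fun E lmax.
Proof. by apply: measurable_funTS; exact: (measurable_lmaximal hs). Qed.

Let lmax0 x : (0 <= lmax x)%E. Proof. exact: (lmaximal_ge0 hs). Qed.

Let mE i k : (\int[mu]_(x in nbhd i `&` superlevel k) lmax x = (m i k)%:E)%E /\ m i k <= W.
Proof.
have le : (\int[mu]_(x in nbhd i `&` superlevel k) lmax x <= W%:E)%E.
  apply: le_trans (integral_lmaximal_nbhd i); apply: ge0_subset_integral => //.
  exact: measurable_nbhd.
have fin : (\int[mu]_(x in nbhd i `&` superlevel k) lmax x)%E \is a fin_num.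
  rewrite ge0_fin_numE; last exact: integral_ge0.
  by apply: le_lt_trans le _; rewrite ltry.
by split; rewrite ?fineK// -lee_fin fineK.
Qed.

(* At each point the levels below the maximal function grow geometrically, so
   their sum is at most twice its value. *)
Let layer n i j : \sum_(k < n | (j <= k)%N) level k * g i k <= 2 * m i j.
Proof.
rewrite -lee_fin EFinM -(mE i j).1 -sumEFin.
have -> : (\sum_(k < n | (j <= k)%N) (level k * g i k)%:E =
    \sum_(k <- [seq k <- index_iota 0 n | (j <= k)%N])
      \int[mu]_(x in nbhd i `&` superlevel j) (cst (level k)%:E \_ (superlevel k)) x)%E.
  rewrite big_filter big_mkord; apply: eq_bigr => k jk.
  rewrite -integral_mkcondr.
  have -> : nbhd i `&` superlevel j `&` superlevel k = nbhd i `&` superlevel k.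
    rewrite -setIA; congr (_ `&` _); apply/seteqP; split => [x []//|x kx].
    by split => //; apply: le_lt_trans kx; rewrite lee_fin level_le.
  by rewrite integral_cst// (gE i k).1 EFinM.
have mc k : measurable_fun setT (cst (level k)%:E \_ (superlevel k)).
  by apply/(measurable_restrictT _ _).1 => //; exact: measurable_superlevel.
have c0 k x : (0 <= (cst (level k)%:E \_ (superlevel k)) x)%E.
  by apply: erestrict_ge0 => y _; rewrite lee_fin ltW// level_gt0.
rewrite -ge0_integral_sum//; last by move=> k; exact: measurable_funTS.
rewrite -ge0_integralZl//.
apply: ge0_le_integral => //.
- by move=> x _; exact: sume_ge0.
- by apply: emeasurable_sum => k; exact: measurable_funTS.
- by apply: emeasurable_funM => //; exact: measurable_cst.
move=> x _; rewrite big_filter big_mkord.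
case lx : (lmax x) (lmax0 x) => [X| |]// X0; last first.
  by rewrite gt0_muley ?leey// lte_fin.
rewrite -EFinM.
have -> : (\sum_(k < n | (j <= k)%N) (cst (level k)%:E \_ (superlevel k)) x =
    (\sum_(k < n | (j <= k)%N && (level k < X)) level k)%:E)%E.
  rewrite -sumEFin [RHS]big_mkcondr/=; apply: eq_bigr => k _; rewrite patchE.
  rewrite (_ : (x \in superlevel k) = (level k < X))//.
  by apply/idP/idP; rewrite inE /superlevel/= lx lte_fin.
rewrite lee_fin.
apply: (@sum_geometric_le _ level 2 X (fun k => (j <= k)%N && (level k < X))) => //.
- by rewrite ler1n.
- by move=> k; exact/ltW/level_gt0.
- move=> k; rewrite [level k.+1]levelE exprS -mulrA -levelE.
  by rewrite (_ : 2 - 1 = 1)// ?mul1r ?ler_pM2r ?level_gt0//; ring.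
- by move=> k /andP[_ /ltW].
Qed.

(** The largest exponent for which the coupling factor of [level_iteration]
    is at most [1/2], the constant there being [2 * D ^+ 2 * A]. *)
Definition gain : R := (8 * D ^+ 4 * A)^-1.

Local Notation e := gain.

Let A0 : 0 < A. Proof. exact: lt_le_trans A1. Qed.

Let eDA : 8 * D ^+ 4 * A * e = 1.
Proof. by rewrite mulfV// gt_eqF// !mulr_gt0// exprn_gt0. Qed.

Lemma gain01 : 0 < gain < 1.
Proof.
rewrite invr_gt0 !mulr_gt0 ?exprn_gt0//= invf_lt1 ?mulr_gt0 ?exprn_gt0//.
have : 1 <= D ^+ 4 * A by rewrite mulr_ege1// exprn_ege1.
by rewrite -mulrA; lra.
Qed.

Let e01 := gain01.
Let e0 : 0 < e. Proof. by case/andP: gain01. Qed.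

Let Tle i k n : (k <= n)%N ->
  level k `^ e <= level i `^ e + e * D * \sum_(j < n | (i <= j < k)%N) level j `^ e.
Proof.
move=> kn; rewrite (levelE k) (levelE i).
under eq_bigr do rewrite levelE.
exact: (level_power_le D2 e01 (level_gt0 0)).
Qed.

Let Gamma1 n : \sum_(k < n) level k `^ e * level k * g 1 k <= D * (4 * level 0 `^ e * W).
Proof.
have tE k : D ^+ k * level 0 = level k by rewrite -levelE.
have W0 : 0 <= W by rewrite mulr_ge0 ?(ltW A0) ?fine_ge0//; exact: integral_ge0.
have c0 : 0 <= 2 * D ^+ 2 * A by rewrite !mulr_ge0 ?exprn_ge0 ?(ltW D0) ?(ltW A0).
suff: \sum_(k < n) (D ^+ k * level 0) `^ e * (D ^+ k * level 0) * g 1 k <=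
    D ^+ 1 * (4 * (D ^+ 0 * level 0) `^ e * W).
  by rewrite expr1 tE; under eq_bigr do rewrite tE.
apply: (level_iteration D2 e01 (level_gt0 0) (c := 2 * D ^+ 2 * A) (V := V)
  (m := m)) => //.
- by rewrite -[leRHS]eDA le_eqVlt; apply/orP; left; apply/eqP; ring.
- by move=> i k; have [] := gE i k.
- by move=> i j; under eq_bigr do rewrite tE; exact: layer.
- move=> i k ik; rewrite tE -lee_fin -(mE i k).1 EFinM -(gE i.+1 k).1.
  exact: integral_lmaximal_superlevel.
- by move=> i k; have [] := mE i k.
Qed.

(* On the set where [sigma] is at most the [n]-th level, its power is bounded
   by a sum over levels, and the [k]-th term lives on the [k]-th superlevel
   set because [sigma] is almost everywhere below its maximal function. *)
Let integral_power_truncated n :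
  (\int[mu]_(x in ball x0 r0 `&` [set x | sigma x <= (level n)%:E]) (sigma x `^ (1 + e))
    <= (2 * level 0 `^ e * mass x0 (K * r0))%:E)%E.
Proof.
set E := ball x0 r0 `&` _.
have mE' : measurable E.
  rewrite /E -[X in X `&` _]setIid -setIA; apply: measurableI.
    exact: (measurable_qball hs).
  apply: emeasurable_fun_infty_c; first exact: (measurable_qball hs).
  exact: measurable_funTS.
have eDT k : 0 <= e * D * level k `^ e.
  by rewrite !mulr_ge0 ?(ltW e0) ?(ltW D0) ?powR_ge0.
pose F k x := ((e * D * level k `^ e)%:E * (sigma \_ (superlevel k)) x)%E.
have ms k : measurable_fun setT (sigma \_ (superlevel k)).
  apply/(measurable_restrictT _ _).1; first exact: measurable_superlevel.
  exact: measurable_funTS.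
have s0 k x : (0 <= (sigma \_ (superlevel k)) x)%E by apply: erestrict_ge0.
have mF k : measurable_fun setT (F k).
  by apply: emeasurable_funM => //; exact: measurable_cst.
have F0 k x : (0 <= F k x)%E by rewrite mule_ge0// lee_fin.
have mT0 : measurable_fun setT (fun x => (level 0 `^ e)%:E * sigma x)%E.
  by apply: emeasurable_funM => //; exact: measurable_cst.
have T00 x : (0 <= (level 0 `^ e)%:E * sigma x)%E by rewrite mule_ge0// lee_fin powR_ge0.
apply: (@le_trans _ _ (\int[mu]_(x in E)
    ((level 0 `^ e)%:E * sigma x + \sum_(k <- index_iota 0 n) F k x))%E).
  apply: ae_ge0_le_integral => //.
  - by move=> x _; exact: poweR_ge0.
  - apply: measurable_funTS; apply: (@measurableT_comp _ _ _ _ _ _ (@poweR R ^~ (1 + e))) => //.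
    exact: measurable_poweR.
  - by move=> x _; rewrite adde_ge0//; exact: sume_ge0.
  - apply: emeasurable_funD; first exact: measurable_funTS.
    by apply: emeasurable_sum => k; exact: measurable_funTS.
  apply: filterS sigma_le_lmaximal => x slx [bx /= sn].
  have {slx} := slx bx.
  case sx : (sigma x) (sigma0 x) sn => [s| |]//=; rewrite !lee_fin => sp sn slx.
  rewrite big_mkord /F.
  have -> : (\sum_(k < n) (e * D * level k `^ e)%:E * (sigma \_ (superlevel k)) x =
      (\sum_(k < n) e * D * level k `^ e * (if x \in superlevel k then s else 0))%:E)%E.
    rewrite -sumEFin; apply: eq_bigr => k _; rewrite patchE sx EFinM.
    by case: ifP.
  rewrite -EFinM -EFinD lee_fin.
  have -> : s `^ (1 + e) = s `^ e * s.
    rewrite addrC powRD ?powRr1//; apply/implyP => /eqP.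
    by have := e0; lra.
  have sum0 : 0 <= \sum_(k < n) e * D * level k `^ e * (if x \in superlevel k then s else 0).
    by apply: sumr_ge0 => k _; rewrite mulr_ge0//; case: ifP.
  have [s_small|s_large] := leP s (level 0).
    apply: ler_wpDr => //; rewrite ler_wpM2r// ge0_ler_powR ?nnegrE ?(ltW e0)//.
    exact/ltW/level_gt0.
  have exk : exists k, s <= level k by exists n.
  case: (ex_minnP exk) => -[|k] sk kmin; first by move: s_large; rewrite ltNge sk.
  have kn : (k < n)%N by exact: kmin.
  have ks : level k < s.
    by rewrite ltNge; apply/negP => /kmin; rewrite ltnn.
  apply: (@le_trans _ _ (level k.+1 `^ e * s)).
    rewrite ler_wpM2r// ge0_ler_powR ?nnegrE ?(ltW e0)//.
    exact/ltW/level_gt0.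
  apply: (@le_trans _ _ ((level 0 `^ e + e * D * \sum_(j < n | (0 <= j < k.+1)%N) level j `^ e) * s)).
    by rewrite ler_wpM2r// Tle.
  rewrite mulrDl lerD2l mulr_sumr mulr_suml big_mkcond/=; apply: ler_sum => j _.
  case: ifPn => [jk|_]; last by rewrite mulr_ge0//; case: ifP.
  rewrite mem_set// /superlevel/=; apply: lt_le_trans slx.
  by rewrite lte_fin; apply: le_lt_trans ks; exact: level_le.
rewrite ge0_integralD//; last 3 first.
- exact: measurable_funTS.
- by move=> x _; exact: sume_ge0.
- by apply: emeasurable_sum => k; exact: measurable_funTS.
rewrite ge0_integral_sum//; last by move=> k; exact: measurable_funTS.
rewrite ge0_integralZl//; last 2 first.
- exact: measurable_funTS.
- by rewrite lee_fin powR_ge0.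
have subK : ball x0 r0 `<=` ball x0 (K * r0).
  by apply: qball_subset; rewrite ler_peMl ?(ltW r0_gt0)//; move: K20; lra.
have T0 : 0 <= level 0 `^ e by exact: powR_ge0.
apply: (@le_trans _ _ ((level 0 `^ e * mass x0 (K * r0))%:E +
    (\sum_(k < n) e * D ^+ 2 * (level k `^ e * level k * g 1 k))%:E)%E).
  apply: leeD.
    rewrite EFinM lee_wpmul2l ?lee_fin// -massE.
    apply: ge0_subset_integral => //; first exact: (measurable_qball hs).
      exact: measurable_funTS.
    by move=> x [/subK].
  rewrite big_mkord -sumEFin; apply: lee_sum => k _.
  rewrite ge0_integralZl ?lee_fin//; last exact: measurable_funTS.
  apply: (@le_trans _ _ ((e * D * level k `^ e)%:E * ((D * level k)%:E * (g 1 k)%:E))%E); last first.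
    by rewrite -!EFinM lee_fin le_eqVlt; apply/orP; left; apply/eqP; ring.
  rewrite lee_wpmul2l ?lee_fin// -(gE 1 k).1 -integral_mkcondr.
  apply: le_trans (integral_superlevel_le (leq0n k)).
  apply: ge0_subset_integral => //.
  - by apply: measurableI => //; exact: measurable_superlevel.
  - exact: measurable_funTS.
  - by move=> x [[bx _] kx].
rewrite -EFinD lee_fin -mulr_sumr.
have eD2 : 0 <= e * D ^+ 2 by rewrite mulr_ge0 ?exprn_ge0 ?(ltW e0) ?(ltW D0).
have M0 : 0 <= level 0 `^ e * mass x0 (K * r0).
  by rewrite mulr_ge0 ?fine_ge0//; exact: integral_ge0.
have : e * D ^+ 2 * (\sum_(k < n) level k `^ e * level k * g 1 k) <=
    level 0 `^ e * mass x0 (K * r0).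
  apply: le_trans (ler_wpM2l eD2 (Gamma1 n)) _.
  have -> : e * D ^+ 2 * (D * (4 * level 0 `^ e * W)) =
    (4 * e * D ^+ 3 * A) * (level 0 `^ e * mass x0 (K * r0)) by rewrite /W; ring.
  rewrite ler_piMl//; apply: le_trans (_ : 8 * D ^+ 4 * A * e <= _); last by rewrite eDA.
  have -> : 8 * D ^+ 4 * A * e = 2 * D * (4 * e * D ^+ 3 * A) by ring.
  rewrite ler_peMl//; last by move: D1; lra.
  by rewrite !mulr_ge0 ?exprn_ge0 ?(ltW e0) ?(ltW D0) ?(ltW A0).
lra.
Qed.

(** The bound [A] on the A_infty constant enters the exponent but not the
    constant in front: the sum of [level_iteration] is proportional to [A],
    and [level_power_le] multiplies it by the exponent gained. *)
Lemma reverse_hoelder :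
  (\int[mu]_(x in ball x0 r0) (sigma x `^ (1 + e)) <=
   (2 * D ^+ 4 * mean `^ (1 + e) * vol x0 r0)%:E)%E.
Proof.
pose E n := ball x0 r0 `&` [set x | (sigma x <= (level n)%:E)%E].
have mb : measurable (ball x0 r0) by exact: (measurable_qball hs).
have mE' n : measurable (E n).
  rewrite /E -[X in X `&` _]setIid -setIA; apply: measurableI => //.
  by apply: emeasurable_fun_infty_c => //; exact: measurable_funTS.
have mp : measurable_fun setT (fun x => sigma x `^ (1 + e))%E.
  apply: (@measurableT_comp _ _ _ _ _ _ (@poweR R ^~ (1 + e))) => //.
  exact: measurable_poweR.
have Dn x : (x < 2 ^+ (Num.truncn x).+1 :> R).
  apply: lt_trans (truncnS_gt x) _; rewrite -natrX ltr_nat.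
  by rewrite ltn_expl.
(* The sets [E n] exhaust the ball up to the null set where [sigma] is
   infinite. *)
have -> : (\int[mu]_(x in ball x0 r0) (sigma x `^ (1 + e)) =
    \int[mu]_(x in \bigcup_n E n) (sigma x `^ (1 + e)))%E.
  have isigma : mu.-integrable (ball x0 r0) sigma.
    apply/integrableP; split; first exact: measurable_funTS.
    by under eq_integral => z _ do rewrite gee0_abs//.
  rewrite integral_mkcond [RHS]integral_mkcond; apply: ge0_ae_eq_integral => //.
  - by apply/(measurable_restrictT _ _).1 => //; exact: measurable_funTS.
  - apply/(measurable_restrictT _ _).1; first exact: bigcup_measurable.
    exact: measurable_funTS.
  - by move=> x _; apply: erestrict_ge0 => y _; exact: poweR_ge0.
  - by move=> x _; apply: erestrict_ge0 => y _; exact: poweR_ge0.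
  apply: filterS (integrable_ae mb isigma) => x finx _.
  rewrite !patchE; congr (if _ then _ else _); apply/idP/idP; rewrite !inE.
    move=> bx; have fx := finx bx.
    exists (Num.truncn (fine (sigma x) / level 0)).+1 => //; split => //=.
    rewrite -(fineK fx) lee_fin levelE; apply: ltW.
    rewrite -ltr_pdivrMr ?level_gt0//; apply: lt_le_trans (Dn _) _.
    by apply: lerXn2r; rewrite ?nnegrE ?(ltW D0).
  by move=> [n _ []].
apply: (@cvge_to_le _ \oo _ _ (fun n => \int[mu]_(x in E n) (sigma x `^ (1 + e))%E)%E); last first.
  apply: nearW => n; apply: le_trans (integral_power_truncated n) _; rewrite lee_fin.
  have mean0 := mean_gt0; have p0 := powR_ge0 mean e.
  have D30 : 0 <= D ^+ 3 by rewrite exprn_ge0 ?(ltW D0).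
  have -> : mass x0 (K * r0) = mean * vol x0 (K * r0).
    by rewrite divfK// gt_eqF// (vol_gt0 hs)// mulr_gt0.
  have -> : mean `^ (1 + e) = mean `^ e * mean.
    rewrite addrC powRD ?powRr1 ?(ltW mean0)//; apply/implyP => /eqP.
    by have := e0; lra.
  apply: (@le_trans _ _ (2 * (D ^+ 3 * mean `^ e) * (mean * (D * vol x0 r0)))); last first.
    by rewrite le_eqVlt; apply/orP; left; apply/eqP; ring.
  have v0 : 0 <= vol x0 (K * r0) by rewrite fine_ge0.
  apply: ler_pM; rewrite ?mulr_ge0 ?powR_ge0 ?(ltW mean0)//.
  - by rewrite fine_ge0//; exact: integral_ge0.
  - rewrite ler_wpM2l// /level add0n powRM ?(ltW mean0)// ler_wpM2r//.
    by rewrite ler1_powR ?exprn_ege1// ltW//; case/andP: gain01.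
  - by rewrite ler_wpM2l ?(ltW mean0)// volK.
apply: ge0_nondecreasing_set_cvg_integral => //.
- move=> n k nk; rewrite subsetEset => x [bx xn]; split => //=.
  by apply: le_trans xn _; rewrite lee_fin level_le.
- by move=> n; exact: measurable_funTS.
- by move=> n x _; exact: poweR_ge0.
Qed.

End stopping.
Arguments gain {R} D A.
Arguments mean {R disp S} d mu K sigma x0 r0.

(** * A weighted Hoelder inequality *)

Lemma integral_weighted_hoelder {R : realType} {disp} {S : measurableType disp}
    (mu : {measure set S -> \bar R}) (B : set S) (f w : S -> R) (q : R) :
    measurable B -> measurable_fun setT f -> (forall x, 0 <= f x) ->
    measurable_fun setT w -> (forall x, 0 <= w x) -> 1 < q ->
    {ae mu, forall x, B x -> 0 < w x} ->
  (\int[mu]_(x in B) (f x)%:E <=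
     (\int[mu]_(x in B) (f x `^ q * w x)%:E) `^ q^-1 *
     (\int[mu]_(x in B) (w x `^ (- (q - 1)^-1))%:E) `^ ((q - 1) / q))%E.
Proof.
move=> mB mf f0 mw w0 q1 wpos.
have q0 : 0 < q by rewrite (lt_trans ltr01).
have q10 : 0 < q - 1 by rewrite subr_gt0.
pose q' := q / (q - 1).
have q'0 : 0 < q' by rewrite divr_gt0.
have mpow (g : S -> R) (a : R) : measurable_fun setT g ->
    measurable_fun setT (fun x => g x `^ a).
  move=> mg; apply: (@measurableT_comp _ _ _ _ _ _ (@powR R ^~ a)) => //.
have mI : measurable_fun setT (\1_B : S -> R) by exact: measurable_indic.
pose F x := f x * w x `^ q^-1 * \1_B x.
pose G x := w x `^ (- q^-1) * \1_B x.
have mF : measurable_fun setT F.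
  by apply: measurable_funM => //; apply: measurable_funM => //; exact: mpow.
have mG : measurable_fun setT G by apply: measurable_funM => //; exact: mpow.
have F0 x : 0 <= F x by rewrite !mulr_ge0 ?powR_ge0.
have G0 x : 0 <= G x by rewrite !mulr_ge0 ?powR_ge0.
have toB (g h : S -> R) : (forall x, B x -> h x = g x) -> (forall x, ~ B x -> h x = 0) ->
    (\int[mu]_x (h x)%:E = \int[mu]_(x in B) (g x)%:E)%E.
  move=> hB hN; rewrite [RHS]integral_mkcond; apply: eq_integral => x _.
  rewrite patchE; have [Bx|Bx] := pselect (B x); first by rewrite mem_set// hB.
  by rewrite memNset// hN.
have indB x : B x -> (\1_B x : R) = 1 by move=> Bx; rewrite indicE mem_set.
have indN x : ~ B x -> (\1_B x : R) = 0 by move=> Bx; rewrite indicE memNset.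
have := hoelder mu mF mG q0 q'0.
have -> : q^-1 + q'^-1 = 1 by rewrite /q' invf_div; field; rewrite gt_eqF.
move=> /(_ erefl); rewrite Lnorm1.
have -> : (\int[mu]_x `|(EFin \o (F \* G)%R) x| = \int[mu]_(x in B) (f x)%:E)%E.
  under eq_integral => x _ do rewrite /= (ger0_norm (mulr_ge0 (F0 x) (G0 x))).
  rewrite [RHS]integral_mkcond; apply: ge0_ae_eq_integral => //.
  - by apply/measurable_EFinP; exact: measurable_funM.
  - apply/(measurable_restrictT _ _).1 => //; apply: measurable_funTS.
    exact/measurable_EFinP.
  - by move=> x _; rewrite lee_fin (mulr_ge0 (F0 x) (G0 x)).
  - by move=> x _; apply: erestrict_ge0 => y _; rewrite lee_fin.
  apply: filterS wpos => x wx _; rewrite patchE.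
  have [Bx|Bx] := pselect (B x); last first.
    by rewrite memNset//= /F indN// mulr0 mul0r.
  rewrite mem_set//=.
  rewrite /F /G indB// !mulr1 -mulrA -powRD ?subrr ?powRr0 ?mulr1//.
  by apply/implyP => _; rewrite gt_eqF// wx.
rewrite unlock.
have -> : (\int[mu]_x `|(EFin \o F) x| `^ q = \int[mu]_(x in B) (f x `^ q * w x)%:E)%E.
  under eq_integral => x _ do rewrite /= ger0_norm//.
  apply: toB => x Bx; rewrite /F; last by rewrite indN// mulr0 powR0// gt_eqF.
  rewrite indB// mulr1 powRM ?powR_ge0// -powRrM mulVf ?gt_eqF// powRr1//.
have -> : (\int[mu]_x `|(EFin \o G) x| `^ q' =
    \int[mu]_(x in B) (w x `^ (- (q - 1)^-1))%:E)%E.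
  under eq_integral => x _ do rewrite /= ger0_norm//.
  apply: toB => x Bx; rewrite /G; last by rewrite indN// mulr0 powR0// gt_eqF.
  rewrite indB// mulr1 -powRrM; congr (_ `^ _); rewrite /q'; field.
  by rewrite !gt_eqF.
by rewrite /q' invf_div.
Qed.

(** * Muckenhoupt weights *)

Lemma npow_negE {R : realType} (y : \bar R) (b : R) : 0 < b -> (0 <= y)%E ->
  npow y (- b) = if y == 0%E then +oo%E else
                 if y == +oo%E then 0%E else ((fine y) `^ (- b))%:E.
Proof.
move=> b0 y0; rewrite /npow oppr_ge0 leNgt b0/= opprK.
case: y y0 => [y| |]//; last by rewrite invey poweR0r// gt_eqF.
rewrite lee_fin => y0 /=; rewrite eqe inver; case: eqVneq => yn0.
  by rewrite poweRyr// gt_eqF.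
by rewrite poweR_EFin -powR_inv1// -powRrM mulN1r.
Qed.

Lemma measurable_npow_neg {R : realType} {disp} {S : measurableType disp}
    (w : S -> \bar R) (b : R) : 0 < b -> measurable_fun setT w ->
  (forall x, 0 <= w x)%E -> measurable_fun setT (fun x => npow (w x) (- b)).
Proof.
move=> b0 mw w0; under eq_fun do rewrite npow_negE//.
have meq y : measurable_fun setT (fun x => w x == y).
  apply: (@measurable_fun_bool _ _ _ _ true).
  rewrite (_ : _ @^-1` _ = w @^-1` [set y]); first exact: mw (emeasurable_set1 _).
  by apply/seteqP; split => x /= /eqP.
apply: measurable_fun_ifT => //; apply: measurable_fun_ifT => //.
apply/measurable_EFinP.
apply: (@measurableT_comp _ _ _ _ _ _ (@powR R ^~ (- b))) => //.
exact: measurableT_comp.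
Qed.

Section Ap_weights.
Context {R : realType} {disp : measure_display} {S : measurableType disp}.
Context {d : S -> S -> R} {mu : {measure set S -> \bar R}} {kappa Cmu : R}.
Context (hs : homogeneous_space d mu kappa Cmu).
Context {p : R} (p1 : 1 < p) {w : S -> \bar R} (Apw : Ap d mu p w).

Local Notation ball := (qball d).
Local Notation vol x r := (fine (mu (ball x r))).
Local Notation sigma := (fun x => npow (w x) (- (p - 1)^-1)).

Let mw : measurable_fun setT w. Proof. by case: Apw => -[]. Qed.
Let w0 x : (0 <= w x)%E. Proof. by case: Apw => -[_ + _]; apply. Qed.
Let p10 : 0 < p - 1. Proof. by rewrite subr_gt0. Qed.
Let a0 : 0 < (p - 1)^-1. Proof. by rewrite invr_gt0. Qed.
Let mball x r : measurable (ball x r). Proof. exact: (measurable_qball hs). Qed.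

Lemma measurable_dual_weight : measurable_fun setT sigma.
Proof. exact: measurable_npow_neg. Qed.

Lemma dual_weight_ge0 x : (0 <= sigma x)%E.
Proof.
rewrite /= npow_negE//; case: ifP => // _; case: ifP => // _.
by rewrite lee_fin powR_ge0.
Qed.

Let ball_Ap x (r : R) : 0 < r ->
  (mule_oo (ball_avg mu w (ball x r)) (ball_avg mu sigma (ball x r) `^ (p - 1))
    <= Ap_const d mu p w)%E.
Proof. by move=> r0; apply: ereal_sup_ubound; exists (ball x r) => //; exists x, r. Qed.

Let ball_avgs x (r : R) : 0 < r -> (ball_avg mu w (ball x r) < +oo)%E /\
  (ball_avg mu sigma (ball x r) < +oo)%E.
Proof.
move=> r0; have := le_lt_trans (ball_Ap x r0) Apw.2; rewrite /mule_oo.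
case: ifPn; first by rewrite ltxx.
rewrite negb_or => /andP[wy sy] _; split; first by rewrite ltey.
by apply: (@lty_poweRy _ _ (p - 1)); rewrite ?gt_eqF// ltey.
Qed.

Let integral_lty f x (r : R) : (forall x, 0 <= f x)%E ->
    (0 < r -> (ball_avg mu f (ball x r) < +oo)%E) ->
  (\int[mu]_(z in ball x r) f z < +oo)%E.
Proof.
move=> f0; have [r0|r0 _] := ltP 0 r; last first.
  rewrite (_ : ball x r = set0) ?integral_set0//.
  apply/seteqP; split => // y /=; rewrite /qball/= => xy.
  by have := lt_le_trans xy r0; rewrite ltNge (dist_ge0 hs).
move=> /(_ isT); rewrite (ball_avgE hs)// !ltey.
apply: contra => /eqP ->.
by rewrite gt0_muley// lte_fin invr_gt0 (vol_gt0 hs).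
Qed.

Lemma integral_weight_lty x r : (\int[mu]_(z in ball x r) w z < +oo)%E.
Proof. by apply: integral_lty => // r0; case: (ball_avgs x r0). Qed.

Lemma integral_dual_weight_lty x r : (\int[mu]_(z in ball x r) sigma z < +oo)%E.
Proof.
apply: integral_lty; first exact: dual_weight_ge0.
by move=> r0; case: (ball_avgs x r0).
Qed.

(** Both [w] and its dual weight are locally integrable, so almost everywhere
    finite, and each is infinite where the other vanishes. *)
Lemma Ap_weight_ae x r : {ae mu, forall z, ball x r z ->
  [/\ w z = (fine (w z))%:E, 0 < fine (w z) &
      sigma z = (fine (w z) `^ (- (p - 1)^-1))%:E]}.
Proof.
have iw : mu.-integrable (ball x r) w.
  apply/integrableP; split; first exact: measurable_funTS.
  under eq_integral do rewrite gee0_abs//.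
  exact: integral_weight_lty.
have is_ : mu.-integrable (ball x r) sigma.
  apply/integrableP; split.
    by apply: measurable_funTS; exact: measurable_dual_weight.
  under eq_integral do rewrite gee0_abs ?dual_weight_ge0//.
  exact: integral_dual_weight_lty.
apply: filterS2 (integrable_ae (mball x r) iw) (integrable_ae (mball x r) is_).
move=> z wf sf bz; have {}wf := wf bz; have {sf} := sf bz.
rewrite /= npow_negE//; case: eqP => // /eqP wn0.
case: eqP wf => [->//|_] wf _; rewrite fineK//; split => //.
by rewrite fine_gt0// lt0e wn0 w0/= ltey_eq wf.
Qed.

Let integral_gt0 f x r : 0 < r -> measurable_fun setT f ->
    (forall x, 0 <= f x)%E -> {ae mu, forall z, ball x r z -> (0 < f z)%E} ->
  (0 < \int[mu]_(z in ball x r) f z)%E.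
Proof.
move=> r0 mf f0 fpos; rewrite lt0e integral_ge0// andbT; apply/eqP => int0.
have /(ae_eq_integral_abs mu (mball x r)) : measurable_fun (ball x r) f.
  exact: measurable_funTS.
under eq_integral do rewrite gee0_abs//.
move=> [+ _] => /(_ int0) feq0.
have : {ae mu, forall z, ~ ball x r z}.
  apply: filterS2 fpos feq0 => z zpos z0 bz.
  by have := zpos bz; rewrite z0// ltxx.
move=> [N [mN N0 subN]].
have : (mu (ball x r) <= mu N)%E.
  apply: le_measure_set => // z bz; apply: subN => /=.
  by move=> /(_ bz).
by rewrite N0 leNgt (mu_qball_gt0 hs).
Qed.

Lemma integral_weight_gt0 x r : 0 < r -> (0 < \int[mu]_(z in ball x r) w z)%E.
Proof.
move=> r0; apply: integral_gt0 => //; apply: filterS (Ap_weight_ae x r) => z h bz.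
by have [-> wz _] := h bz; rewrite lte_fin.
Qed.

Lemma integral_dual_weight_gt0 x r : 0 < r ->
  (0 < \int[mu]_(z in ball x r) sigma z)%E.
Proof.
move=> r0; apply: integral_gt0 => //; first exact: measurable_dual_weight.
  exact: dual_weight_ge0.
apply: filterS (Ap_weight_ae x r) => z h bz.
by have [_ wz ->] := h bz; rewrite lte_fin powR_gt0.
Qed.

Local Notation wmass x r := (fine (\int[mu]_(z in ball x r) w z)%E).
Local Notation smass x r := (fine (\int[mu]_(z in ball x r) sigma z)%E).

Lemma Ap_bound x r : 0 < r ->
  ((wmass x r / vol x r * (smass x r / vol x r) `^ (p - 1))%:E
     <= Ap_const d mu p w)%E.
Proof.
move=> r0; apply: le_trans (ball_Ap x r0); rewrite /mule_oo ifF.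
  rewrite !(ball_avgE hs)//.
  have wE : (\int[mu]_(z in ball x r) w z)%E = (wmass x r)%:E.
    rewrite fineK// ge0_fin_numE; first exact: integral_weight_lty.
    exact: integral_ge0.
  have sE : (\int[mu]_(z in ball x r) sigma z)%E = (smass x r)%:E.
    rewrite fineK// ge0_fin_numE; first exact: integral_dual_weight_lty.
    by apply: integral_ge0 => z _; exact: dual_weight_ge0.
  by rewrite wE sE -!EFinM lee_fin ![_^-1 * _]mulrC.
have [wy sy] := ball_avgs x r0.
by apply/negbTE; rewrite negb_or -!ltey wy poweR_lty.
Qed.

Lemma Ap_const_gt0 (x : S) : (0 < Ap_const d mu p w)%E.
Proof.
apply: lt_le_trans (Ap_bound x ltr01); rewrite lte_fin.
have v0 := vol_gt0 hs x ltr01.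
have wm : 0 < wmass x 1.
  by rewrite fine_gt0// integral_weight_gt0 ?integral_weight_lty.
have sm : 0 < smass x 1.
  by rewrite fine_gt0// integral_dual_weight_gt0 ?integral_dual_weight_lty.
by rewrite mulr_gt0 ?powR_gt0 ?divr_gt0.
Qed.

End Ap_weights.

(** * The weighted maximal inequality *)

Section weighted_maximal.
Context {R : realType} {disp : measure_display} {S : measurableType disp}.
Context {d : S -> S -> R} {mu : {measure set S -> \bar R}} {kappa Cmu : R}.
Context (hs : homogeneous_space d mu kappa Cmu).
Context {K D : R}.
Context (Kkappa : 20 * kappa ^+ 5 <= K) (D2 : 2 <= D).
Context (volK : forall (x : S) (r : R), 0 < r ->
  fine (mu (qball d x (K * r))) <= D * fine (mu (qball d x r))).
Context {p : R} (p1 : 1 < p) {w : S -> \bar R} (Apw : Ap d mu p w).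
Local Notation sigma := (fun x => npow (w x) (- (p - 1)^-1)).
Context {A : R} (A1 : 1 <= A).
Context (Ainfty : forall (x : S) (r : R), 0 < r ->
  (\int[mu]_(z in qball d x r) maximal d mu (sigma \_ (qball d x r)) z <=
   A%:E * \int[mu]_(z in qball d x r) sigma z)%E).
Context {Aw : R} (Aw0 : 0 < Aw) (AwE : (Ap_const d mu p w <= Aw%:E)%E).

Local Notation ball := (qball d).
Local Notation vol x r := (fine (mu (ball x r))).
Local Notation wmass x r := (fine (\int[mu]_(z in ball x r) w z)%E).
Local Notation smass x r := (fine (\int[mu]_(z in ball x r) sigma z)%E).

Local Notation e := (gain D A).

(** Chosen so that [w ^ (- 1 / (q - 1))] is the power [1 + e] of [sigma]. *)
Definition lower_exponent : R := 1 + (p - 1) / (1 + gain D A).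

Local Notation q := lower_exponent.

Let e0 : 0 < e. Proof. by case/andP: (gain01 D2 A1). Qed.
Let e10 : 0 < 1 + e. Proof. by rewrite addr_gt0. Qed.
Let p10 : 0 < p - 1. Proof. by rewrite subr_gt0. Qed.
Let D0 : 0 < D. Proof. by apply: lt_le_trans D2. Qed.
Let q1E : q - 1 = (p - 1) / (1 + e). Proof. by rewrite /q; ring. Qed.
Let q10 : 0 < q - 1. Proof. by rewrite q1E divr_gt0. Qed.
Let q1 : 1 < q. Proof. by rewrite -subr_gt0. Qed.
Let q0 : 0 < q. Proof. by rewrite (lt_trans _ q1). Qed.
Let pqE : p - q = (p - 1) * e / (1 + e).
Proof. by rewrite /q; field; rewrite gt_eqF. Qed.
Let pq0 : 0 < p - q. Proof. by rewrite pqE divr_gt0// mulr_gt0. Qed.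

Let mball x r : measurable (ball x r). Proof. exact: (measurable_qball hs). Qed.
Let mw : measurable_fun setT w. Proof. by case: Apw => -[]. Qed.
Let w0 x : (0 <= w x)%E. Proof. by case: Apw => -[_ + _]; apply. Qed.
Let msigma := measurable_dual_weight p1 Apw.
Let sigma0 := dual_weight_ge0 p1 Apw.

Let K20 : 20 <= K.
Proof.
apply: le_trans Kkappa; have : 1 <= kappa ^+ 5 by rewrite exprn_ege1// (kappa_ge1 hs).
by lra.
Qed.
Let K0 : 0 < K. Proof. by apply: lt_le_trans K20. Qed.

Let wE x r : (\int[mu]_(z in ball x r) w z)%E = (wmass x r)%:E.
Proof.
rewrite fineK// ge0_fin_numE; first exact: (integral_weight_lty hs p1 Apw).
exact: integral_ge0.
Qed.

Lemma dual_power_integral x r : 0 < r ->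
  (\int[mu]_(z in ball x r) (fine (w z) `^ (- (q - 1)^-1))%:E <=
   (2 * D ^+ 4 * mean d mu K sigma x r `^ (1 + e) * vol x r)%:E)%E.
Proof.
move=> r0.
apply: le_trans (reverse_hoelder hs Kkappa D2 volK msigma sigma0
  (integral_dual_weight_lty hs p1 Apw) (integral_dual_weight_gt0 hs p1 Apw)
  A1 Ainfty x r0).
rewrite le_eqVlt; apply/orP; left; apply/eqP; apply: ge0_ae_eq_integral => //.
- apply: measurable_funTS; apply/measurable_EFinP.
  apply: (@measurableT_comp _ _ _ _ _ _ (@powR R ^~ _)) => //.
  exact: measurableT_comp.
- apply: measurable_funTS.
  apply: (@measurableT_comp _ _ _ _ _ _ (@poweR R ^~ (1 + e))) => //.
  exact: measurable_poweR.
- by move=> z _; rewrite lee_fin powR_ge0.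
- by move=> z _; exact: poweR_ge0.
apply: filterS (Ap_weight_ae hs p1 Apw x r) => z h bz.
have [_ _ ->] := h bz.
rewrite poweR_EFin -powRrM; congr (_ `^ _)%:E; rewrite q1E; field.
by rewrite !gt_eqF.
Qed.

Definition weak_const : R := (2 * D ^+ 4) `^ (q - 1) * D * Aw.

Lemma weak_const_gt0 : 0 < weak_const.
Proof. by rewrite !mulr_gt0 ?powR_gt0 ?mulr_gt0 ?exprn_gt0. Qed.

(** Hoelder's inequality, with the dual weight raised to the power that the
    reverse Hoelder inequality allows; after that only [Ap_const] at the
    exponent [p] is involved, on the dilated ball. *)
Lemma ball_weak_type (f : S -> R) x r s :
    measurable_fun setT f -> (forall z, 0 <= f z) -> 0 < r -> 0 < s ->
    ((s * vol x r)%:E <= \int[mu]_(z in ball x r) (f z)%:E)%E ->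
  (\int[mu]_(z in ball x (K * r)) w z <=
   (weak_const * s `^ (- q))%:E *
     \int[mu]_(z in ball x r) ((f z `^ q)%:E * w z))%E.
Proof.
move=> mf f0 r0 s0 sI.
have mfine : measurable_fun setT (fine \o w) by exact: measurableT_comp.
have mfq : measurable_fun setT (fun z => f z `^ q).
  by apply: (@measurableT_comp _ _ _ _ _ _ (@powR R ^~ q)).
have Kr0 : 0 < K * r by rewrite mulr_gt0.
have v0 := vol_gt0 hs x r0; have vK0 := vol_gt0 hs x Kr0.
have m0 : 0 < mean d mu K sigma x r.
  exact: (mean_gt0 hs Kkappa (integral_dual_weight_lty hs p1 Apw)
    (integral_dual_weight_gt0 hs p1 Apw)).
set X := (\int[mu]_(z in ball x r) ((f z `^ q)%:E * w z))%E.
have X0 : (0 <= X)%E.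
  by apply: integral_ge0 => z _; rewrite mule_ge0// lee_fin powR_ge0.
have XE : (\int[mu]_(z in ball x r) (f z `^ q * (fine \o w) z)%:E)%E = X.
  apply: ge0_ae_eq_integral => //.
  - by apply: measurable_funTS; apply/measurable_EFinP; exact: measurable_funM.
  - apply: measurable_funTS; apply: emeasurable_funM => //.
    exact/measurable_EFinP.
  - by move=> z _; rewrite lee_fin mulr_ge0 ?powR_ge0 ?fine_ge0.
  - by move=> z _; rewrite mule_ge0// lee_fin powR_ge0.
  apply: filterS (Ap_weight_ae hs p1 Apw x r) => z h bz.
  by have [-> _ _] := h bz.
have wpos : {ae mu, forall z, ball x r z -> 0 < (fine \o w) z}.
  by apply: filterS (Ap_weight_ae hs p1 Apw x r) => z h /h[].
have hold := integral_weighted_hoelder (mball x r) mf f0 mfine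
  (fun z => fine_ge0 (w0 z)) q1 wpos.
rewrite XE in hold; have {sI}hold := le_trans sI hold.
have Yle := dual_power_integral x r0.
set m := mean _ _ _ _ _ _ in Yle m0 *.
have Y0 : (0 <= \int[mu]_(z in ball x r) (fine (w z) `^ (- (q - 1)^-1))%:E)%E.
  by apply: integral_ge0 => z _; rewrite lee_fin powR_ge0.
have [y y0 yE] : exists2 y, 0 <= y &
    (\int[mu]_(z in ball x r) (fine (w z) `^ (- (q - 1)^-1))%:E)%E = y%:E.
  exists (fine (\int[mu]_(z in ball x r) (fine (w z) `^ (- (q - 1)^-1))%:E)%E).
    exact: fine_ge0.
  by rewrite fineK// ge0_fin_numE//; apply: le_lt_trans Yle _; rewrite ltry.
rewrite yE lee_fin in Yle; rewrite /= yE in hold.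
have W0 := weak_const_gt0; have sq0 : 0 < s `^ (- q) by rewrite powR_gt0.
case XX : X X0 hold => [X'| |]// X0 hold; last first.
  by rewrite gt0_muley ?leey// lte_fin mulr_gt0.
rewrite lee_fin in X0; rewrite !poweR_EFin -EFinM lee_fin in hold.
rewrite wE -EFinM lee_fin powRN /weak_const.
have sv0 : 0 < s * vol x r by rewrite mulr_gt0.
have hold' : s `^ q * vol x r `^ q <= X' * y `^ (q - 1).
  have := ge0_ler_powR (ltW q0).
  move=> /(_ (s * vol x r) (X' `^ q^-1 * y `^ ((q - 1) / q))).
  rewrite !nnegrE (ltW sv0) mulr_ge0 ?powR_ge0// => /(_ isT isT hold).
  rewrite (powRM q (ltW s0) (ltW v0)) (powRM q (powR_ge0 _ _) (powR_ge0 _ _)).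
  by rewrite -!powRrM mulVf ?gt_eqF// powRr1// divfK ?gt_eqF.
have y_le : y `^ (q - 1) <= (2 * D ^+ 4) `^ (q - 1) * m `^ (p - 1) * vol x r `^ (q - 1).
  have D4 : 0 <= 2 * D ^+ 4 by rewrite mulr_ge0// exprn_ge0// ltW.
  have -> : p - 1 = (1 + e) * (q - 1) by rewrite q1E mulrC divfK// gt_eqF.
  have Dm : 0 <= 2 * D ^+ 4 * m `^ (1 + e) by rewrite mulr_ge0// powR_ge0.
  rewrite powRrM -(powRM _ D4 (powR_ge0 _ _)) -(powRM _ Dm (ltW v0)).
  by apply: ge0_ler_powR; rewrite ?nnegrE ?(ltW q10)// mulr_ge0// ltW.
have testing : wmass x (K * r) * m `^ (p - 1) <= Aw * (D * vol x r).
  have := le_trans (Ap_bound hs p1 Apw x Kr0) AwE.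
  rewrite lee_fin -/m => H.
  apply: (@le_trans _ _ (Aw * vol x (K * r))); last first.
    by rewrite ler_wpM2l ?(ltW Aw0)// volK.
  by rewrite -ler_pdivrMr// mulrAC.
have wm0 : 0 <= wmass x (K * r) by rewrite fine_ge0//; exact: integral_ge0.
have vq : vol x r `^ q = vol x r * vol x r `^ (q - 1).
  by rewrite mulr_powRB1// ltW.
have sqp : 0 < s `^ q by rewrite powR_gt0.
rewrite [leRHS]mulrAC ler_pdivlMr//.
rewrite -(ler_pM2r (powR_gt0 q v0)) -[leLHS]mulrA.
apply: le_trans (ler_wpM2l wm0 hold') _.
apply: le_trans (ler_wpM2l wm0 (ler_wpM2l X0 y_le)) _.
set c := (2 * D ^+ 4) `^ (q - 1); set v := vol x r `^ (q - 1) in vq *.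
have c0 : 0 <= c by exact: powR_ge0.
have v'0 : 0 <= v by exact: powR_ge0.
have -> : wmass x (K * r) * (X' * (c * m `^ (p - 1) * v)) =
  (X' * c * v) * (wmass x (K * r) * m `^ (p - 1)) by ring.
apply: le_trans (ler_wpM2l _ testing) _; first by rewrite !mulr_ge0.
by rewrite vq le_eqVlt; apply/orP; left; apply/eqP; ring.
Qed.


Let dilation_le : kappa * (4 * kappa + 1) <= K.
Proof.
have k1 := kappa_ge1 hs.
have h m n : (m <= n)%N -> kappa ^+ m <= kappa ^+ n by exact: ler_weXn2l.
have := h 1%N 5%N isT; have := h 2%N 5%N isT; rewrite expr1.
have -> : kappa * (4 * kappa + 1) = 4 * kappa ^+ 2 + kappa by ring.
have := Kkappa; have : 0 <= kappa ^+ 5 by rewrite exprn_ge0// (le_trans ler01).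
lra.
Qed.

Section function.
Context {f : S -> R} (mf : measurable_fun setT f) (f0 : forall x, 0 <= f x).

Definition upper_part t x := f x * \1_[set y | t / 2 < f y] x.

Let cutE t x : upper_part t x = if t / 2 < f x then f x else 0.
Proof.
rewrite /upper_part indicE; case: ifPn => tf; first by rewrite mem_set// mulr1.
by rewrite memNset ?mulr0//; exact/negP.
Qed.

Let cut_ge0 t x : 0 <= upper_part t x. Proof. by rewrite cutE; case: ifP. Qed.

Let measurable_cut t : measurable_fun setT (upper_part t).
Proof.
apply: measurable_funM => //; apply: measurable_indic.
rewrite (_ : [set y | _] = f @^-1` `]t / 2, +oo[%classic).
  by rewrite -[X in measurable X]setTI; apply: mf => //; exact: measurable_itv.
by apply/seteqP; split => x /=; rewrite in_itv/= andbT.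
Qed.

(** The part of [f] below [t / 2] contributes at most [t / 2] to averages, so
    every ball with average above [t] can be tested on the upper part. *)
Lemma weak_type r0 t : 0 < t ->
  (\int[mu]_(x in [set x | (t%:E < lmaximal d mu r0 (EFin \o f) x)%E]) w x <=
   (weak_const * (t / 2) `^ (- q))%:E *
      \int[mu]_x ((upper_part t x `^ q)%:E * w x))%E.
Proof.
move=> t0; have t20 : 0 < t / 2 by rewrite divr_gt0.
pose F : set (S * R) := [set b | 0 < b.2 <= r0 /\
  (t%:E < ball_avg mu (EFin \o f) (ball b.1 b.2))%E].
have mEf : measurable_fun setT (EFin \o f) by exact/measurable_EFinP.
have mcq : measurable_fun setT (fun x => (upper_part t x `^ q)%:E * w x)%E.
  apply: emeasurable_funM => //; apply/measurable_EFinP.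
  by apply: (@measurableT_comp _ _ _ _ _ _ (@powR R ^~ q)).
apply: (vitali_integral hs (F := F) (M := r0)) => //.
- by move=> b [].
- by move=> x; rewrite mule_ge0// lee_fin powR_ge0.
- exact/(measurable_qopen hs)/(qopen_lmaximal_gt hs).
- move=> x /= /lmaximal_gt[y [r [r0r yx ty]]].
  by exists (y, r).
- by rewrite mulr_ge0 ?powR_ge0// ltW// weak_const_gt0.
move=> b [/andP[b0 br0] tb].
apply: (@le_trans _ _ (\int[mu]_(z in ball b.1 (K * b.2)) w z)%E).
  by apply: (ge0_le_integral_qball hs) => //; apply: qball_subset; rewrite ler_pM2r.
apply: ball_weak_type => //.
move: tb; rewrite (ball_avg_gt hs)// => tb.
have mc := measurable_cut t.
have : (\int[mu]_(y in ball b.1 b.2) (EFin \o f) y <=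
    \int[mu]_(y in ball b.1 b.2) (upper_part t y)%:E + (t / 2 * vol b.1 b.2)%:E)%E.
  rewrite EFinM -(mu_qballE hs) -integral_cst// -ge0_integralD//; last 3 first.
  - by move=> y _; rewrite lee_fin.
  - by apply: measurable_funTS; exact/measurable_EFinP.
  - by move=> y _; rewrite lee_fin ltW.
  apply: ge0_le_integral => //.
  - by move=> y _; rewrite lee_fin.
  - exact: measurable_funTS.
  - by apply: emeasurable_funD => //; apply: measurable_funTS; exact/measurable_EFinP.
  move=> y _; rewrite -EFinD lee_fin cutE; case: ifPn; first by rewrite lerDl ltW.
  by rewrite add0r -leNgt.
move=> /(lt_le_trans tb).
have : (0 <= \int[mu]_(y in ball b.1 b.2) (upper_part t y)%:E)%E.
  by apply: integral_ge0 => y _; rewrite lee_fin.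
case: (\int[mu]_(y in ball b.1 b.2) (upper_part t y)%:E)%E => [I| |]//; last by move=> _ _; rewrite leey.
by rewrite -EFinD !lte_fin !lee_fin => _; lra.
Qed.

(** ** Summing over dyadic levels *)

Let lev (n k : nat) : R := 2 ^+ k / 2 ^+ n.

Let lev_gt0 n k : 0 < lev n k.
Proof. by rewrite divr_gt0 ?exprn_gt0. Qed.

Let levS n k : lev n k.+1 = 2 * lev n k.
Proof. by rewrite /lev exprS mulrA. Qed.

Let lev_shift n k m : lev (n + m) (k + m) = lev n k.
Proof.
by rewrite /lev !exprD; field; rewrite !expf_neq0.
Qed.

Let superlev n k := [set x | ((lev n k)%:E < lmaximal d mu n%:R (EFin \o f) x)%E].

Let measurable_superlev n k : measurable (superlev n k).
Proof. exact/(measurable_qopen hs)/(qopen_lmaximal_gt hs). Qed.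

(* Up to a factor [2 ^ p], the [p]-th power of the maximal function over radii
   at most [n], truncated to values between [2 ^ -n] and [2 ^ n]; radii and
   range grow with [n] together, so that a single limit is taken. *)
Let approx n x : R := \sum_(k < n.*2) lev n k.+1 `^ p * \1_(superlev n k) x.

(** The sum of the geometric series of ratio [2 ^ (q - p)]. *)
Definition geometric_const : R := (1 - 2^-1 `^ (p - q))^-1.

Let half_lt1 : 2^-1 `^ (p - q) < 1 :> R.
Proof.
rewrite [ltRHS](_ : 1 = 1 `^ (p - q)); last by rewrite powR1.
apply: gt0_ltr_powR => //.
- by rewrite nnegrE invr_ge0.
- by rewrite nnegrE.
- by lra.
Qed.

(* The weak type bound at the exponent [q] is used on each level [t]; at a
   given point, only the levels [t < 2 f] contribute, and the sum of
   [t ^ (p - q)] over them is a geometric series. *)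
Let integral_approx n :
  (\int[mu]_x ((approx n x)%:E * w x) <=
   (weak_const * 4 `^ p * geometric_const)%:E * \int[mu]_x ((f x `^ p)%:E * w x))%E.
Proof.
have W0 := weak_const_gt0.
have mrw k : measurable_fun setT (w \_ (superlev n k)).
  by apply/(measurable_restrictT _ _).1 => //; exact: measurable_funTS.
have rw0 k x : (0 <= (w \_ (superlev n k)) x)%E by exact: erestrict_ge0.
have lp0 k : 0 <= lev n k.+1 `^ p by exact: powR_ge0.
have -> : (\int[mu]_x ((approx n x)%:E * w x) =
    \sum_(k <- index_iota 0 n.*2)
      (lev n k.+1 `^ p)%:E * \int[mu]_(x in superlev n k) w x)%E.
  transitivity (\int[mu]_x (\sum_(k <- index_iota 0 n.*2)
      (lev n k.+1 `^ p)%:E * (w \_ (superlev n k)) x))%E.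
    apply: eq_integral => x _; rewrite big_mkord /approx -sumEFin ge0_sume_distrl.
      apply: eq_bigr => k _; rewrite EFinM -muleA; congr (_ * _)%E.
      by rewrite patchE indicE; case: ifP => _; rewrite ?mul1e ?mul0e.
    by move=> k _; rewrite lee_fin mulr_ge0.
  rewrite ge0_integral_sum//; last first.
  - by move=> k x _; rewrite mule_ge0// lee_fin.
  - by move=> k; apply: emeasurable_funM => //; exact: measurable_cst.
  apply: eq_bigr => k _.
  by rewrite ge0_integralZl ?lee_fin// -integral_mkcond.
have mcut k : measurable_fun setT (fun x => (upper_part (lev n k) x `^ q)%:E * w x)%E.
  apply: emeasurable_funM => //; apply/measurable_EFinP.
  by apply: (@measurableT_comp _ _ _ _ _ _ (@powR R ^~ q)).
have cw0 k x : (0 <= (upper_part (lev n k) x `^ q)%:E * w x)%E.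
  by rewrite mule_ge0// lee_fin powR_ge0.
pose c k : R := lev n k.+1 `^ p * (weak_const * (lev n k / 2) `^ (- q)).
have c0 k : 0 <= c k by rewrite !mulr_ge0 ?powR_ge0// ltW.
apply: (@le_trans _ _ (\sum_(k <- index_iota 0 n.*2)
    (c k)%:E * \int[mu]_x ((upper_part (lev n k) x `^ q)%:E * w x))%E).
  apply: lee_sum => k _; rewrite /c EFinM -muleA lee_wpmul2l ?lee_fin//.
  exact: weak_type.
have -> : (\sum_(k <- index_iota 0 n.*2)
      (c k)%:E * \int[mu]_x ((upper_part (lev n k) x `^ q)%:E * w x) =
    \int[mu]_x (\sum_(k <- index_iota 0 n.*2)
      (c k)%:E * ((upper_part (lev n k) x `^ q)%:E * w x)))%E.
  rewrite ge0_integral_sum//; last first.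
  - by move=> k x _; rewrite mule_ge0// lee_fin.
  - by move=> k; apply: emeasurable_funM => //; exact: measurable_cst.
  by apply: eq_bigr => k _; rewrite ge0_integralZl ?lee_fin.
have mfp : measurable_fun setT (fun x => (f x `^ p)%:E * w x)%E.
  apply: emeasurable_funM => //; apply/measurable_EFinP.
  by apply: (@measurableT_comp _ _ _ _ _ _ (@powR R ^~ p)).
have fw0 x : (0 <= (f x `^ p)%:E * w x)%E by rewrite mule_ge0// lee_fin powR_ge0.
have G0 : 0 < geometric_const by rewrite invr_gt0 subr_gt0.
have C0 : 0 <= weak_const * 4 `^ p * geometric_const.
  exact: mulr_ge0 (mulr_ge0 (ltW W0) (powR_ge0 _ _)) (ltW G0).
rewrite -ge0_integralZl ?lee_fin//; apply: ge0_le_integral => //.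
- by move=> x _; apply: sume_ge0 => k _; rewrite mule_ge0// lee_fin.
- apply: emeasurable_sum => k; apply: emeasurable_funM => //.
- by apply: emeasurable_funM => //; exact: measurable_cst.
move=> x _; rewrite big_mkord.
under eq_bigr do rewrite muleA -EFinM.
rewrite -ge0_sume_distrl; last by move=> k _; rewrite lee_fin mulr_ge0 ?powR_ge0.
rewrite muleA -EFinM sumEFin lee_wpmul2r// lee_fin.
pose a k : R := lev n k `^ (p - q).
have term k : c k * upper_part (lev n k) x `^ q =
    if lev n k < 2 * f x then weak_const * 2 `^ p * 2 `^ q * f x `^ q * a k else 0.
  rewrite cutE ltr_pdivrMr// (mulrC (f x)); case: ifP => // _; last first.
    by rewrite powR0 ?mulr0// gt_eqF.
  rewrite /c /a levS powRM ?(ltW (lev_gt0 _ _))// powRM ?(ltW (lev_gt0 _ _))//.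
  have -> : 2^-1 `^ (- q) = 2 `^ q :> R.
    by rewrite -[2^-1]powR_inv1// -powRrM mulN1r opprK.
  have -> : lev n k `^ (p - q) = lev n k `^ p * lev n k `^ (- q).
    by rewrite powRD//; apply/implyP => _; rewrite gt_eqF.
  by ring.
under eq_bigr do rewrite term.
rewrite -big_mkcond/= -mulr_sumr.
have fx0 := f0 x.
have geo : \sum_(k < n.*2 | lev n k < 2 * f x) a k <=
    geometric_const * (2 * f x) `^ (p - q).
  apply: (@sum_geometric_le _ a geometric_const _ (fun k => lev n k < 2 * f x)) => //.
  - by rewrite invf_ge1 ?subr_gt0// lerBlDr lerDl powR_ge0.
  - exact: powR_ge0.
  - by move=> k; exact: powR_ge0.
  - move=> k; rewrite /a levS powRM ?(ltW (lev_gt0 _ _))//.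
    rewrite mulrA ler_wpM2r ?powR_ge0// le_eqVlt; apply/orP; left; apply/eqP.
    have h2 : 2^-1 `^ (p - q) * 2 `^ (p - q) = 1 :> R.
      by rewrite -powRM// mulVf// powR1.
    have := half_lt1; rewrite /geometric_const; move: h2.
    set u := 2^-1 `^ _; set v := 2 `^ _ => uv u1.
    have -> : (1 - u)^-1 - 1 = u * (1 - u)^-1.
      by field; rewrite gt_eqF// subr_gt0.
    by rewrite mulrAC uv mul1r.
  - move=> k /ltW kf; apply: ge0_ler_powR; rewrite ?nnegrE ?(ltW pq0)//.
      exact/ltW/lev_gt0.
    by rewrite mulr_ge0.
apply: le_trans (ler_wpM2l _ geo) _.
  by do 3![apply: mulr_ge0; last exact: powR_ge0]; exact: ltW.
rewrite le_eqVlt; apply/orP; left; apply/eqP.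
rewrite powRM//.
have -> : 4 `^ p = 2 `^ p * 2 `^ p :> R by rewrite -powRM// -natrM.
have [fx|fx] := eqVneq (f x) 0.
  have fq : f x `^ q = 0 by rewrite fx powR0// gt_eqF.
  have fp : f x `^ p = 0 by rewrite fx powR0// gt_eqF// (lt_trans ltr01).
  by rewrite fq fp !(mulr0, mul0r).
have -> : 2 `^ p = 2 `^ q * 2 `^ (p - q) :> R.
  by rewrite -powRD; [congr (_ `^ _); ring|rewrite pnatr_eq0 implybT].
have -> : f x `^ p = f x `^ q * f x `^ (p - q).
  by rewrite -powRD; [congr (_ `^ _); ring|rewrite fx implybT].
by ring.
Qed.

Let approx_ge0 n x : 0 <= approx n x.
Proof. by apply: sumr_ge0 => k _; rewrite mulr_ge0 ?powR_ge0. Qed.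

Let levSS n k : lev n.+1 k.+1 = lev n k.
Proof. by rewrite -(lev_shift n k 1) !addn1. Qed.

Let approx_homo x : {homo approx ^~ x : n m / (n <= m)%N >-> n <= m}.
Proof.
apply: homo_leq => [//|m n k|n]; first exact: le_trans.
rewrite /approx doubleS big_ord_recl big_ord_recr/=.
rewrite -[leLHS]addr0 -[leLHS]add0r; apply: lerD.
  by rewrite mulr_ge0 ?powR_ge0.
apply: lerD; last by rewrite mulr_ge0 ?powR_ge0.
apply: ler_sum => k _; rewrite /bump/= add1n.
rewrite levSS ler_wpM2l ?powR_ge0// !indicE ler_nat.
case: (boolP (x \in superlev n k)) => //; rewrite inE => xk.
rewrite mem_set// /superlev/= levSS; apply: lt_le_trans xk _.
apply: lmaximal_le => y r /andP[r0 rn] yx; apply: lmaximal_ge => //.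
by rewrite r0 (le_trans rn)// ler_nat.
Qed.

Local Notation M := (maximal d mu (EFin \o f)).

Let approx_large N i x : ((lev N i)%:E < M x)%E ->
  exists n, lev N i.+1 `^ p <= approx n x.
Proof.
move=> /maximal_gt[y [r [r0 yx Nr]]].
pose m := (Num.truncn r + i).+1; exists (N + m)%N.
have im : (i + m < (N + m).*2)%N.
  rewrite -addnn -addSn; apply: leq_add; last exact: leq_addl.
  by rewrite (leq_trans _ (leq_addl N m))// /m ltnS leq_addl.
rewrite /approx (bigD1 (Ordinal im))//= -[leLHS]addr0 lerD//; last first.
  by apply: sumr_ge0 => k _; rewrite mulr_ge0 ?powR_ge0.
rewrite -addSn lev_shift indicE mem_set ?mulr1//.
rewrite /superlev/= lev_shift.
apply: lt_le_trans (_ : ball_avg mu (EFin \o f) (ball y r) <= _)%E.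
  suff <- : abse \o (EFin \o f) = EFin \o f by [].
  by apply/funext => z /=; rewrite ger0_norm.
apply: lmaximal_ge => //; rewrite r0/=.
apply: le_trans (ltW (truncnS_gt r)) _; rewrite ler_nat.
by rewrite /m -addSn addnCA leq_addr.
Qed.

Lemma integral_maximal_power :
  (\int[mu]_x (M x `^ p * w x) <=
   (weak_const * 4 `^ p * geometric_const)%:E * \int[mu]_x ((f x `^ p)%:E * w x))%E.
Proof.
have p0 : 0 < p by rewrite (lt_trans ltr01).
have M0 x : (0 <= M x)%E by exact: (maximal_ge0 hs).
have mapprox n : measurable_fun setT (fun x => (approx n x)%:E * w x)%E.
  apply: emeasurable_funM => //; apply/measurable_EFinP.
  apply: measurable_sum => k; exact: measurable_funM.
have aw0 n x : (0 <= (approx n x)%:E * w x)%E by rewrite mule_ge0// lee_fin.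
have aw_homo x : {homo (fun n => (approx n x)%:E * w x)%E : n m / (n <= m)%N >-> (n <= m)%E}.
  by move=> n m nm; rewrite lee_wpmul2r// lee_fin approx_homo.
have is_cvg x : cvgn (fun n => (approx n x)%:E * w x)%E.
  by apply: ereal_nondecreasing_is_cvgn => n m nm; exact: aw_homo.
apply: (@le_trans _ _ (\int[mu]_x limn (fun n => (approx n x)%:E * w x))%E).
  have mMp : measurable_fun setT (fun x => M x `^ p * w x)%E.
    apply: emeasurable_funM => //.
    apply: (@measurableT_comp _ _ _ _ _ _ (@poweR R ^~ p)).
      exact: measurable_poweR.
    exact: (measurable_maximal hs).
  apply: ge0_le_integral => //.
  - by move=> x _; rewrite mule_ge0// poweR_ge0.
  - apply: (emeasurable_fun_cvg (fun n x => ((approx n x)%:E * w x)%E)) => //.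
  move=> x _.
  have le_lim n : ((approx n x)%:E * w x <= limn (fun n => (approx n x)%:E * w x))%E.
    by apply: lime_ge => //; exists n => // k; exact: aw_homo.
  have [wx0|wx0] := eqVneq (w x) 0%E.
    have -> : (M x `^ p * w x = 0)%E by rewrite wx0 mule0.
    exact: le_trans (aw0 0%N x) (le_lim 0%N).
  have wx : (0 < w x)%E by rewrite lt0e wx0 w0.
  have pow2_gt (y : R) : y < 2 ^+ (Num.truncn y).+1.
    by apply: lt_trans (truncnS_gt y) _; rewrite -natrX ltr_nat ltn_expl.
  case MX : (M x) (M0 x) => [X| |]// X0.
    have [->|Xn0] := eqVneq X 0.
      rewrite poweR_EFin powR0 ?gt_eqF// mul0e.
      exact: le_trans (aw0 0%N x) (le_lim 0%N).
    have {X0}Xn0 : 0 < X by rewrite lt_neqAle eq_sym Xn0.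
    pose N := (Num.truncn X^-1).+1.
    have exk : exists k, X <= lev N k.
      exists (N + (Num.truncn X).+1)%N.
      by rewrite -{1}(add0n N) (addnC N) lev_shift /lev expr0 divr1 ltW.
    case: (ex_minnP exk) => -[|k] Xk kmin.
      exfalso; move: Xk; rewrite /lev expr0 div1r leNgt => /negP; apply.
      by rewrite invf_plt ?posrE ?exprn_gt0// pow2_gt.
    have /approx_large[n npow] : ((lev N k)%:E < M x)%E.
      rewrite MX lte_fin ltNge; apply/negP => /kmin.
      by rewrite ltnn.
    apply: le_trans (le_lim n); rewrite lee_wpmul2r// poweR_EFin lee_fin.
    apply: le_trans npow; apply: ge0_ler_powR; rewrite ?nnegrE ?(ltW p0)//.
      exact: ltW.
    exact/ltW/lev_gt0.
  rewrite poweRyr ?gt_eqF// gt0_mulye//.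
  have large c : exists n, c <= approx n x.
    have [|n npow] := @approx_large 0 (Num.truncn c).+1 x.
      by rewrite MX ltry.
    exists n; apply: le_trans npow; rewrite /lev expr0 divr1.
    apply: le_trans (ltW (pow2_gt c)) _.
    apply: (@le_trans _ _ (2 ^+ (Num.truncn c).+2)).
      by rewrite ler_weXn2l// ler1n.
    by apply: le1r_powR; rewrite ?exprn_ege1 ?ler1n// ltW.
  move: le_lim; set L := limn _ => le_lim.
  rewrite leye_eq; apply/eqP/eq_infty => c.
  case wX : (w x) wx => [u| |]// wx; last first.
    have [n n1] := large 1; apply: le_trans (le_lim n).
    by rewrite wX gt0_muley ?leey// lte_fin (lt_le_trans ltr01).
  have [n nc] := large (c / u); apply: le_trans (le_lim n).
  rewrite wX -EFinM lee_fin -ler_pdivrMr//.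
rewrite monotone_convergence//.
apply: lime_le; last by apply: nearW => n; exact: integral_approx.
apply: ereal_nondecreasing_is_cvgn => n m nm; apply: ge0_le_integral => //.
by move=> x _; exact: aw_homo.
Qed.

End function.

End weighted_maximal.
Arguments lower_exponent {R} D p A.
Arguments weak_const {R} D p A Aw.
Arguments geometric_const {R} D p A.

(** * Constants *)

Section constants.
Context {R : realType}.

(** The exponent gained is comparable to [(p - 1) / A], which is where the
    factor [A / (p - 1)] of the theorem comes from. *)
Lemma geometric_const_le (D A p : R) : 2 <= D -> 1 <= A -> 1 < p ->
  geometric_const D p A <= 32 * D ^+ 4 * expR p * (A / (p - 1)).
Proof.
move=> D2 A1 p1; have /andP[e0 e1] := gain01 D2 A1.
have D0 : 0 < D by apply: lt_le_trans D2.
have A0 : 0 < A by apply: lt_le_trans A1.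
have p10 : 0 < p - 1 by rewrite subr_gt0.
have D4 : 1 <= D ^+ 4 by rewrite exprn_ege1// (le_trans _ D2)// ler1n.
have E1 : 1 + p <= expR p by exact: expR_ge1Dx.
rewrite /geometric_const; set eta := p - lower_exponent D p A.
have etaE : eta = (p - 1) * gain D A / (1 + gain D A).
  by rewrite /eta /lower_exponent; field; rewrite gt_eqF// addr_gt0.
have eta0 : 0 < eta by rewrite etaE divr_gt0 ?(mulr_gt0 p10 e0) ?(addr_gt0 ltr01 e0).
have [eta1|eta1] := ltP eta 1.
  have half : 2^-1 `^ eta <= 1 - eta / 2.
    have h2 : 0 <= (2^-1 : R) by rewrite invr_ge0.
    have eta1' : 0 < 1 - eta by rewrite subr_gt0.
    have := @conjugate_powR R (2^-1 `^ eta) 1 eta^-1 (1 - eta)^-1 (powR_ge0 _ _) ler01.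
    rewrite !invr_gt0 !invrK => /(_ eta0 eta1').
    rewrite -powRrM mulfV ?gt_eqF// powRr1// powR1 mulr1.
    have -> : eta + (1 - eta) = 1 by ring.
    by move=> /(_ erefl); lra.
  apply: (@le_trans _ _ (eta / 2)^-1).
    rewrite lef_pV2 ?posrE ?divr_gt0//; first by move: half; lra.
    by move: half eta0; lra.
  rewrite etaE invf_div.
  have -> : 2 / ((p - 1) * gain D A / (1 + gain D A)) =
      2 * (1 + gain D A) * (8 * D ^+ 4 * A) / (p - 1).
    rewrite -[8 * _ * _](invrK) -/(gain D A); field.
    by rewrite !gt_eqF// addr_gt0.
  rewrite [leRHS]mulrA ler_wpM2r ?invr_ge0 ?(ltW p10)//.
  have DA : 0 <= D ^+ 4 * A by rewrite mulr_ge0 ?(ltW A0)// (le_trans ler01).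
  apply: (@le_trans _ _ (32 * (D ^+ 4 * A))).
    have : (1 + gain D A) * (D ^+ 4 * A) <= 2 * (D ^+ 4 * A).
      by rewrite ler_wpM2r//; lra.
    by lra.
  have : D ^+ 4 * A <= expR p * (D ^+ 4 * A) by rewrite ler_peMl//; lra.
  by lra.
have half : 2^-1 `^ eta <= 2^-1.
  rewrite -[leRHS]powRr1 ?invr_ge0//; apply: ger_powR => //.
  by rewrite invr_gt0 ltr0n/= invf_le1// ler1n.
apply: (@le_trans _ _ 2).
  rewrite -[leRHS]invrK lef_pV2 ?posrE ?invr_gt0//; first by move: half; lra.
  by move: half; lra.
rewrite [leRHS]mulrA ler_pdivlMr//.
apply: (@le_trans _ _ (32 * expR p)); first by lra.
have E0 : 0 <= 32 * expR p by rewrite mulr_ge0// expR_ge0.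
have : 1 * (32 * expR p) <= D ^+ 4 * A * (32 * expR p).
  by rewrite ler_wpM2r// mulr_ege1.
by lra.
Qed.

Lemma maximal_const_le (D A Aw p : R) : 2 <= D -> 1 <= A -> 1 < p -> 0 < Aw ->
  weak_const D p A Aw * 4 `^ p * geometric_const D p A <=
  (4 * (2 * D ^+ 4) * D * (32 * D ^+ 4) * expR 1) `^ p * ((p - 1)^-1 * Aw * A).
Proof.
move=> D2 A1 p1 Aw0; have /andP[e0 e1] := gain01 D2 A1.
have D0 : 0 < D by apply: lt_le_trans D2.
have D1 : 1 <= D by apply: le_trans D2; rewrite ler1n.
have A0 : 0 < A by apply: lt_le_trans A1.
have p10 : 0 < p - 1 by rewrite subr_gt0.
have D4 : 1 <= D ^+ 4 by rewrite exprn_ege1.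
have D40 : 0 <= D ^+ 4 by exact: le_trans ler01 D4.
have h2 : 1 <= 2 * D ^+ 4 by lra.
have h32 : 1 <= 32 * D ^+ 4 by lra.
have q_le : lower_exponent D p A - 1 <= p.
  rewrite /lower_exponent addrAC subrr add0r ler_pdivrMr ?addr_gt0//.
  have : 0 <= p * gain D A by rewrite mulr_ge0 ?(ltW e0)//; lra.
  by lra.
have c1 : (2 * D ^+ 4) `^ (lower_exponent D p A - 1) <= (2 * D ^+ 4) `^ p.
  exact: ler_powR.
have c2 : D <= D `^ p by apply: le1r_powR => //; exact: ltW.
have c3 : 32 * D ^+ 4 <= (32 * D ^+ 4) `^ p by apply: le1r_powR => //; exact: ltW.
have c4 := geometric_const_le D2 A1 p1.
have E0 := expR_gt0 p.
have AA : 0 <= A / (p - 1) by rewrite divr_ge0 ?(ltW A0) ?(ltW p10).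
rewrite /weak_const; set X := (2 * D ^+ 4) `^ (_ - 1) in c1 *.
have X0 : 0 <= X by exact: powR_ge0.
clearbody X; set P := 2 * D ^+ 4 in h2 c1 *.
set Q := 32 * D ^+ 4 in h32 c3 c4 *.
have P0 : 0 <= P by exact: le_trans ler01 h2.
have Q0 : 0 <= Q by exact: le_trans ler01 h32.
clearbody P Q.
rewrite !powRM ?expR_ge0 ?mulr_ge0 ?(ltW D0)// -expRM mul1r.
set Y := P `^ p in c1 *; set Z := D `^ p in c2 *.
set V := Q `^ p in c3 *; set F := 4 `^ p.
set G := geometric_const _ _ _ in c4 *.
have F0 : 0 <= F by exact: powR_ge0.
have Y0 : 0 <= Y by exact: powR_ge0.
have Z0 : 0 <= Z by exact: powR_ge0.
have G_le : G <= V * expR p * (A / (p - 1)).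
  by apply: le_trans c4 _; rewrite ler_wpM2r// ler_wpM2r// ltW.
have -> : F * Y * Z * V * expR p * ((p - 1)^-1 * Aw * A) =
  Y * Z * Aw * F * (V * expR p * (A / (p - 1))) by ring.
apply: (@le_trans _ _ (X * D * Aw * F * (V * expR p * (A / (p - 1))))).
  by rewrite ler_wpM2l// !mulr_ge0// ltW.
apply: ler_wpM2r.
  by rewrite mulr_ge0// mulr_ge0 ?(ltW E0)//; exact: powR_ge0.
rewrite ler_wpM2r// ler_wpM2r ?(ltW Aw0)//.
by apply: ler_pM => //; exact: ltW.
Qed.

End constants.

(** * The theorem *)

Section Ainfty.
Context {R : realType} {disp : measure_display} {S : measurableType disp}.
Context {d : S -> S -> R} {mu : {measure set S -> \bar R}} {kappa Cmu : R}.
Context (hs : homogeneous_space d mu kappa Cmu).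
Context {sigma : S -> \bar R} (sigma0 : forall x, (0 <= sigma x)%E).
Context (sigma_fin : forall x r, (\int[mu]_(z in qball d x r) sigma z < +oo)%E).
Context (sigma_gt0 : forall (x : S) (r : R), 0 < r ->
  (0 < \int[mu]_(z in qball d x r) sigma z)%E).

Let massE x r : (\int[mu]_(z in qball d x r) sigma z)%E =
  (fine (\int[mu]_(z in qball d x r) sigma z)%E)%:E.
Proof. by rewrite fineK// ge0_fin_numE//; exact: integral_ge0. Qed.

Let mass_gt0 x (r : R) : 0 < r -> 0 < fine (\int[mu]_(z in qball d x r) sigma z)%E.
Proof. by move=> r0; rewrite fine_gt0// sigma_gt0//= sigma_fin. Qed.

Lemma Ainfty_bound (A : R) x (r : R) : (Ainfty_const d mu sigma <= A%:E)%E -> 0 < r ->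
  (\int[mu]_(z in qball d x r) maximal d mu (sigma \_ (qball d x r)) z <=
   A%:E * \int[mu]_(z in qball d x r) sigma z)%E.
Proof.
move=> AA r0; have s0 := mass_gt0 x r0.
have : ((\int[mu]_(z in qball d x r) sigma z)^-1 *
    \int[mu]_(z in qball d x r) maximal d mu (sigma \_ (qball d x r)) z <= A%:E)%E.
  apply: le_trans AA; apply: ereal_sup_ubound; exists (qball d x r) => //.
  by exists x, r.
rewrite massE inver gt_eqF// lee_pdivrMl//.
by rewrite muleC.
Qed.

(** The ball itself is admissible in the maximal function. *)
Lemma Ainfty_ge1 (A : R) (x : S) : (Ainfty_const d mu sigma <= A%:E)%E -> 1 <= A.
Proof.
move=> /(Ainfty_bound x)/(_ ltr01).
have s0 := mass_gt0 x ltr01; have v0 := vol_gt0 hs x ltr01.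
set s := fine _ in s0; set B := qball d x 1.
have mB : measurable B by exact: (measurable_qball hs).
move=> H; have : (s%:E <= A%:E * s%:E)%E.
  rewrite -massE; apply: le_trans H.
  have -> : (\int[mu]_(z in B) sigma z = \int[mu]_(z in B) cst (ball_avg mu sigma B) z)%E.
    rewrite integral_cst// (ball_avgE hs)// -/B massE -/s (mu_qballE hs) -!EFinM.
    by rewrite mulrAC mulVf ?mul1r// gt_eqF.
  apply: ge0_le_integral => //.
  - by move=> z _; exact: ball_avg_ge0.
  - by apply: measurable_funTS; exact: (measurable_maximal hs).
  - move=> z Bz; apply: le_trans (maximal_ge _ ltr01 Bz).
    rewrite /ball_avg le_eqVlt; apply/orP; left; apply/eqP; congr (_ * _)%E.
    apply: eq_integral => v; rewrite inE => Bv.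
    by rewrite /= patchE mem_set// gee0_abs.
by rewrite -EFinM lee_fin ler_pMl.
Qed.

End Ainfty.

(** It is enough to treat nonnegative functions: [maximal] only sees absolute
    values. *)
Lemma maximal_opnorm_le {R : realType} {disp : measure_display}
    {S : measurableType disp} (d : S -> S -> R) (mu : {measure set S -> \bar R})
    (p C : R) (w : S -> \bar R) : 0 < p -> 0 <= C ->
    (forall x, 0 <= w x)%E ->
    (forall f : S -> R, measurable_fun setT f -> (forall x, 0 <= f x)%R ->
      \int[mu]_x (maximal d mu (EFin \o f) x `^ p * w x) <=
      C%:E * \int[mu]_x ((f x `^ p)%:E * w x))%E ->
    (forall (f : S -> \bar R) x, 0 <= maximal d mu f x)%E ->
  (maximal_opnorm d mu p w <= (C `^ p^-1)%:E)%E.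
Proof.
move=> p0 C0 w0 strong M0; apply: ge_ereal_sup => _ [f [mf f1] <-].
have abs_f : maximal d mu (EFin \o f) = maximal d mu (EFin \o (fun x => `|f x|)).
  apply/funext => x; rewrite /maximal; congr (ereal_sup (image _ _)).
  by apply/funext => B; congr (ball_avg mu _ B); apply/funext => y /=; rewrite normr_id.
have mabs : measurable_fun setT (fun x => `|f x|) by exact: measurableT_comp.
have := strong _ mabs (fun x => normr_ge0 _); rewrite -abs_f => H.
have {f1} : (\int[mu]_x ((`|f x| `^ p)%:E * w x) <= 1)%E.
  set I := (X in (X <= _)%E).
  have I0 : (0 <= I)%E.
    by apply: integral_ge0 => x _; rewrite mule_ge0// lee_fin powR_ge0.
  have I1 : (I `^ p^-1 <= 1)%E by exact: f1.
  have -> : I = ((I `^ p^-1) `^ p)%E by rewrite -poweRrM mulVf ?gt_eqF// poweRe1.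
  rewrite -(poweR1r p); apply: gt0_ler_poweR => //; first exact: ltW.
  - by rewrite in_itv/= poweR_ge0 leey.
  - by rewrite in_itv/= lee01 leey.
move=> If; rewrite /wLnorm.
under eq_integral do rewrite gee0_abs//.
apply: (@le_trans _ _ (C%:E `^ p^-1)%E); last by [].
apply: gt0_ler_poweR; first by rewrite invr_ge0 ltW.
- by rewrite in_itv/= leey andbT; apply: integral_ge0 => x _; rewrite mule_ge0// poweR_ge0.
- by rewrite in_itv/= leey lee_fin C0.
apply: le_trans H _.
by rewrite -[leRHS]mule1 lee_wpmul2l// lee_fin.
Qed.

Unset Implicit Arguments.

Theorem theorem1p3 (R : realType) (kappa Cmu : R) :
  exists A : R, 0 < A /\
    forall (disp : measure_display) (S : measurableType disp)
           (d : S -> S -> R) (mu : {measure set S -> \bar R}),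
      homogeneous_space d mu kappa Cmu ->
      forall (p p' : R) (w sigma : S -> \bar R),
        1 < p -> p^-1 + p'^-1 = 1 ->
        Ap d mu p w ->
        sigma = (fun x => npow (w x) (1 - p')) ->
        (maximal_opnorm d mu p w <=
           A%:E * (((p - 1)^-1)%:E * Ap_const d mu p w
                    * Ainfty_const d mu sigma) `^ p^-1)%E.
Proof.
(* A power of 2, so that the doubling property can be iterated, beyond the
   multiple of [kappa ^+ 5] that the geometry of stopping balls asks for. *)
pose n := (Num.truncn (20 * kappa ^+ 5)).+1.
pose K : R := 2 ^+ n; pose D := Num.max 2 (Cmu ^+ n).
have D2 : 2 <= D by rewrite le_max lexx.
have D0 : 0 < D by apply: lt_le_trans D2.
have K_ge : 20 * kappa ^+ 5 <= K.
  apply: le_trans (ltW (truncnS_gt _)) _.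
  by rewrite /K -natrX ler_nat ltnW// ltn_expl.
exists (4 * (2 * D ^+ 4) * D * (32 * D ^+ 4) * expR 1).
split; first by rewrite !mulr_gt0 ?exprn_gt0 ?expR_gt0.
set C := _ * expR 1.
have C0 : 0 < C by rewrite !mulr_gt0 ?exprn_gt0 ?expR_gt0.
move=> disp S d mu hs p p' w sigma p1 pp' Apw.
have p0 : 0 < p by rewrite (lt_trans ltr01).
have p10 : 0 < p - 1 by rewrite subr_gt0.
have -> : 1 - p' = - (p - 1)^-1.
  have p'E : p'^-1 = (p - 1) / p.
    have -> : p'^-1 = 1 - p^-1 by rewrite -pp' addrAC subrr add0r.
    by field; rewrite gt_eqF.
  by rewrite -[p']invrK p'E; field; rewrite !gt_eqF.
move=> sigmaE.
(* Otherwise every number would be a doubling constant. *)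
have [x0] : exists x0 : S, True.
  apply: contrapT => S0; have [_ /(_ (Cmu - 1))] := hs_doubling hs.
  apply/not_implyP; split; first by move=> x; exfalso; apply: S0; exists x.
  by apply/negP; rewrite -ltNge ltrBlDr ltrDl.
move=> _; have volK (x : S) (r : R) : 0 < r ->
    fine (mu (qball d x (K * r))) <= D * fine (mu (qball d x r)).
  move=> r0; apply: le_trans (vol_doubling hs n x r0) _.
  by rewrite ler_wpM2r ?fine_ge0// le_max lexx orbT.
have Aw0 := Ap_const_gt0 hs p1 Apw x0; have := Apw.2.
case AwE : (Ap_const d mu p w) Aw0 => [Aw| |]// Aw0 _; rewrite lte_fin in Aw0.
have s0 x : (0 <= sigma x)%E by rewrite sigmaE; exact: (dual_weight_ge0 p1 Apw).
have s_fin x r : (\int[mu]_(z in qball d x r) sigma z < +oo)%E.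
  by rewrite sigmaE; exact: (integral_dual_weight_lty hs p1 Apw).
have s_gt0 (x : S) (r : R) : 0 < r -> (0 < \int[mu]_(z in qball d x r) sigma z)%E.
  by rewrite sigmaE; exact: (integral_dual_weight_gt0 hs p1 Apw).
have pA0 : 0 < (p - 1)^-1 * Aw by rewrite mulr_gt0// invr_gt0.
case AE : (Ainfty_const d mu sigma) => [A| |].
- have A_le : (Ainfty_const d mu sigma <= A%:E)%E by rewrite AE.
  have A1 := Ainfty_ge1 hs s0 s_fin s_gt0 x0 A_le.
  have Abound (x : S) (r : R) := @Ainfty_bound _ _ _ _ _ _ s0 s_fin s_gt0 A x r A_le.
  rewrite sigmaE in Abound.
  have Aw_le : (Ap_const d mu p w <= Aw%:E)%E by rewrite AwE.
  have T0 : 0 <= (p - 1)^-1 * Aw * A by rewrite mulr_ge0 ?(ltW pA0)// (le_trans ler01).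
  have CT0 : 0 <= C `^ p * ((p - 1)^-1 * Aw * A) by rewrite mulr_ge0 ?powR_ge0.
  have -> : (C%:E * ((p - 1)^-1%:E * Aw%:E * A%:E) `^ p^-1)%E =
      ((C `^ p * ((p - 1)^-1 * Aw * A)) `^ p^-1)%:E.
    rewrite powRM ?powR_ge0// -powRrM mulfV ?gt_eqF// powRr1 ?(ltW C0)//.
  apply: maximal_opnorm_le => //; first by case: Apw => -[].
    move=> f mf f0; apply: le_trans
      (integral_maximal_power hs K_ge D2 volK p1 Apw A1 Abound Aw0 Aw_le mf f0) _.
    apply: lee_wpmul2r.
      apply: integral_ge0 => x _; rewrite mule_ge0 ?lee_fin ?powR_ge0//.
      by case: Apw => -[_ + _]; apply.
    by rewrite lee_fin; exact: maximal_const_le.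
  exact: (maximal_ge0 hs).
- rewrite -EFinM gt0_muley ?lte_fin// poweRyr ?gt0_muley ?leey ?lte_fin//.
  by rewrite invr_eq0 gt_eqF.
- have : (Ainfty_const d mu sigma <= 0%:E)%E by rewrite AE leNye.
  by move=> /(Ainfty_ge1 hs s0 s_fin s_gt0 x0); rewrite ler10.
Qed.
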